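(* A graph $G$ can be explained by a labeled network that is elementary and quasi-discriminating if and only if $G$ is either a caterpillar-explainable cograph with at least two vertices or a polar-cat.
   Context: Graphs finite, simple, undirected; $G-v$, join, cograph (no induced $P_4$). Network on finite $X$: a DAG $N=(V,E)$ with either $V=X=\{x\}$, or (N1) unique root $\rho_N$ of indegree 0, outdegree $\ge2$; (N2) $x\in X$ iff outdegree 0, indegree 1; (N3) every other non-root vertex has indegree 1 and outdegree $\ge2$, or indegree 2 (hybrid-vertex) and outdegree $\ge1$. Level-1: each biconnected component of the underlying undirected graph has at most one hybrid-vertex; lowest common ancestors $\mathrm{lca}_N(x,y)$ are then unique. Labeled network: $t:V\to\{0,1,\odot\}$ with $t(v)=\odot$ iff $v\in X$; it explains $G$ if $G$ is isomorphic to the graph on $X$ with $x\ne y$ adjacent iff $t(\mathrm{lca}_N(x,y))=1$. $N$ is elementary if it consists of a single cycle (biconnected component) $C$ with $|X|+1$ vertices, containing $\rho_N$ and a hybrid-vertex, together with one edge from each vertex of $C$ other than $\rho_N$ to a leaf, these leaves being pairwise distinct and forming $X$. $(N,t)$ is quasi-discriminating if $t(u)\ne t(v)$ for every edge $(u,v)$ with $u,v\notin X$ and $v$ not a hybrid-vertex. A caterpillar is a rooted tree whose inner vertices each have two children and induce a path with the root at one end; a cherry is a pair of leaves with a common parent. A cograph is caterpillar-explainable if its unique discriminating cotree (labeled tree explaining it in which adjacent inner vertices have different labels) is a caterpillar. $G$ is a $(v,G_1,G_2)$-pseudo-cograph if $G_1,G_2$ are induced subgraphs, $v\in V(G)$,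 with $V(G)=V(G_1)\cup V(G_2)$, $V(G_1)\cap V(G_2)=\{v\}$, $|V(G_1)|,|V(G_2)|>1$, $G_1,G_2$ cographs, and $G-v$ the join or disjoint union of $G_1-v,G_2-v$. Such $G$ with $|V(G)|\ge4$ is a $(v,G_1,G_2)$-polar-cat if either ($G_1,G_2$ both connected and $G-v$ the disjoint union of $G_1-v,G_2-v$) or ($G_1,G_2$ both disconnected and $G-v$ the join), and $G_1,G_2$ are caterpillar-explainable with $v$ part of a cherry in both explaining caterpillars. A polar-cat is a $(v,G_1,G_2)$-polar-cat for some $v,G_1,G_2$. *)

(* Defs.v *)
From mathcomp Require Import all_boot.
Set Implicit Arguments. Unset Strict Implicit. Unset Printing Implicit Defensive.

(* Graphs: a finite simple graph is (T : finType, adj : rel T) with adj *)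
(* symmetric and irreflexive (these are hypotheses of the theorem).     *)

Definition induced (T : finType) (adj : rel T) (A : {set T})
  : rel {x : T | x \in A} := fun a b => adj (val a) (val b).
Arguments induced {T} adj A.

Definition cograph (T : finType) (adj : rel T) : Prop :=
  forall a b c d : T,
    adj a b -> adj b c -> adj c d -> ~~ adj a c -> ~~ adj b d -> ~~ adj a d ->
    False.

Definition connected_on (T : finType) (adj : rel T) (A : {set T}) : Prop :=
  forall x y, x \in A -> y \in A ->
    connect [rel a b | [&& adj a b, a \in A & b \in A]] x y.

Definition indeg n (E : rel 'I_n) (v : 'I_n) : nat := #|[set u | E u v]|.
Definition outdeg n (E : rel 'I_n) (v : 'I_n) : nat := #|[set w | E v w]|.

Definition acyclic n (E : rel 'I_n) : Prop :=
  forall u v, E u v -> ~~ connect E v u.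

Definition is_root n (E : rel 'I_n) (r : 'I_n) : Prop := indeg E r = 0.

Definition hybrid n (E : rel 'I_n) (v : 'I_n) : Prop := indeg E v = 2.

Definition network n (E : rel 'I_n) (X : {set 'I_n}) : Prop :=
  acyclic E /\
  ( (X = [set: 'I_n] /\ #|X| = 1)
  \/ exists rho : 'I_n,
      [/\ (* N1 *) indeg E rho = 0, 2 <= outdeg E rho,
          (forall v, indeg E v = 0 -> v = rho),
          (* N2 *) (forall x, x \in X <-> (outdeg E x = 0 /\ indeg E x = 1)) &
          (* N3 *) (forall v, v != rho -> v \notin X ->
                     (indeg E v = 1 /\ 2 <= outdeg E v) \/
                     (indeg E v = 2 /\ 1 <= outdeg E v))]).

Definition tree n (E : rel 'I_n) (X : {set 'I_n}) : Prop :=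
  network E X /\ forall v, indeg E v <= 1.

Inductive label := l0 | l1 | lodot.

Definition labeling n (X : {set 'I_n}) (t : 'I_n -> label) : Prop :=
  forall v, t v = lodot <-> v \in X.

Definition is_lca n (E : rel 'I_n) (x y w : 'I_n) : Prop :=
  [/\ connect E w x, connect E w y &
      forall w', connect E w' x -> connect E w' y -> connect E w w' -> w' = w].

Definition explains_via (T : finType) (adj : rel T) n (E : rel 'I_n)
  (X : {set 'I_n}) (t : 'I_n -> label) (f : T -> 'I_n) : Prop :=
  [/\ injective f,
      (forall v, v \in X <-> exists x, f x = v) &
      forall x y, x != y ->
        (adj x y <-> exists w, is_lca E (f x) (f y) w /\ t w = l1)].

Definition elementary n (E : rel 'I_n) (X : {set 'I_n}) : Prop :=
  exists (C : {set 'I_n}) (rho h : 'I_n) (s : seq 'I_n) (l : 'I_n -> 'I_n),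
  [/\ C = ~: X /\ #|C| = #|X| + 1,
      [/\ rho \in C, indeg E rho = 0, h \in C & hybrid E h],
      [/\ uniq s, 3 <= size s, (forall u, (u \in s) = (u \in C)) &
          forall u v, u \in C -> v \in C ->
            (E u v || E v u) = ((next s u == v) || (next s v == u))],
      (forall x v, x \in X -> ~~ E x v) &
      [/\ forall u x, u \in C -> x \in X -> E u x = (u != rho) && (l u == x),
          forall u, u \in C -> u != rho -> l u \in X,
          {in C :\ rho &, injective l} &
          forall x, x \in X -> exists2 u, u \in C :\ rho & l u = x]].

Definition quasi_discriminating n (E : rel 'I_n) (X : {set 'I_n})
  (t : 'I_n -> label) : Prop :=
  forall u v, E u v -> u \notin X -> v \notin X -> ~ hybrid E v -> t u <> t v.

Definition elem_qd_explainable (T : finType) (adj : rel T) : Prop :=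
  exists n (E : rel 'I_n) (X : {set 'I_n}) (t : 'I_n -> label) (f : T -> 'I_n),
    [/\ network E X, elementary E X, labeling X t,
        quasi_discriminating E X t & explains_via adj E X t f].

Definition discriminating n (E : rel 'I_n) (X : {set 'I_n})
  (t : 'I_n -> label) : Prop :=
  forall u v, E u v -> u \notin X -> v \notin X -> t u <> t v.

Definition consec (V : eqType) (p : seq V) (u v : V) : Prop :=
  exists i, [/\ i.+1 < size p, nth u p i = u & nth u p i.+1 = v].

Definition caterpillar n (E : rel 'I_n) (X : {set 'I_n}) : Prop :=
  tree E X /\
  (forall u, u \notin X -> outdeg E u = 2) /\
  exists (rho : 'I_n) (p : seq 'I_n),
    [/\ indeg E rho = 0, uniq (rho :: p),
        (forall u, (u \in rho :: p) = (u \notin X)) &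
        forall u v, u \notin X -> v \notin X ->
          (E u v || E v u) <-> (consec (rho :: p) u v \/ consec (rho :: p) v u)].

Definition in_cherry n (E : rel 'I_n) (X : {set 'I_n}) (u : 'I_n) : Prop :=
  u \in X /\ exists u' p, [/\ u' \in X, u' != u, E p u & E p u'].

(* discriminating cotree explaining G that is a caterpillar; the
   discriminating cotree of a cograph is unique *)
Definition cat_cotree (T : finType) (adj : rel T) n (E : rel 'I_n)
  (X : {set 'I_n}) (t : 'I_n -> label) (f : T -> 'I_n) : Prop :=
  [/\ tree E X, labeling X t, discriminating E X t,
      explains_via adj E X t f & caterpillar E X].

Definition caterpillar_explainable (T : finType) (adj : rel T) : Prop :=
  cograph adj /\
  exists n (E : rel 'I_n) X t (f : T -> 'I_n), cat_cotree adj E X t f.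

Definition caterpillar_explainable_cherry (T : finType) (adj : rel T) (w : T)
  : Prop :=
  cograph adj /\
  exists n (E : rel 'I_n) X t (f : T -> 'I_n),
    cat_cotree adj E X t f /\ in_cherry E X (f w).

Definition join_parts (T : finType) (adj : rel T) (v : T) (A1 A2 : {set T}) :=
  forall x y, x \in A1 :\ v -> y \in A2 :\ v -> adj x y.

Definition disjoint_parts (T : finType) (adj : rel T) (v : T) (A1 A2 : {set T}) :=
  forall x y, x \in A1 :\ v -> y \in A2 :\ v -> ~~ adj x y.

Definition pseudo_cograph (T : finType) (adj : rel T) (v : T)
  (A1 A2 : {set T}) : Prop :=
  [/\ A1 :|: A2 = [set: T], A1 :&: A2 = [set v],
      1 < #|A1|, 1 < #|A2| &
      [/\ cograph (induced adj A1), cograph (induced adj A2) &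
          (join_parts adj v A1 A2 \/ disjoint_parts adj v A1 A2)]].

Definition polar_cat_at (T : finType) (adj : rel T) (v : T)
  (A1 A2 : {set T}) : Prop :=
  [/\ pseudo_cograph adj v A1 A2, 4 <= #|T|,
      (connected_on adj A1 /\ connected_on adj A2 /\ disjoint_parts adj v A1 A2)
      \/ (~ connected_on adj A1 /\ ~ connected_on adj A2 /\
          join_parts adj v A1 A2),
      (exists2 w : {x : T | x \in A1}, val w = v &
         caterpillar_explainable_cherry (induced adj A1) w) &
      (exists2 w : {x : T | x \in A2}, val w = v &
         caterpillar_explainable_cherry (induced adj A2) w)].

Definition polar_cat (T : finType) (adj : rel T) : Prop :=
  exists v A1 A2, polar_cat_at adj v A1 A2.

(* Main.v *)
Require Import Defs.
From mathcomp Require Import all_boot.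
From mathcomp Require Import zify.

(** The leaves of a quasi-discriminating elementary network hang, one each, from
the vertices of two directed paths from the root [rho] to the hybrid vertex [h].
Two leaves of one path have as lca the vertex carrying the upper one, and the
labels alternate along a path below [rho] (the label of [h] is never an lca of
two leaves); leaves of different paths have lca [rho].  So the explained graph
consists of two vertex sequences sharing their last element, along each of which
adjacency of [x_i] and [x_j], i < j, is [c (+) odd i] for one common [c], while
adjacency across is constantly [~~ c].  A single such sequence is exactly what a
discriminating caterpillar cotree with the last element in its cherry explains.
Since a sequence induces a connected graph iff [c], two sequences form a
polar-cat; if one of them is just [h], or if both have length two, the whole
graph is a single sequence. *)

Set Implicit Arguments. Unset Strict Implicit. Unset Printing Implicit Defensive.

(** * Lowest common ancestors in acyclic digraphs *)

Section Digraph.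
Variables (n : nat) (E : rel 'I_n).
Implicit Types u v w x y : 'I_n.

Lemma connect_parent w v :
  connect E w v -> w = v \/ exists2 u, connect E w u & E u v.
Proof.
case/connectP=> p; case/lastP: p => [|p u]; first by move=> _ ->; left.
rewrite rcons_path last_rcons => /andP[pE uE] ->; right.
by exists (last w p) => //; apply/connectP; exists p.
Qed.

(** Confines ancestors: with [P] describing one side of a cycle, it limits the common ancestors of
    leaves on different sides. *)
Lemma connect_ancestor_closed (P : pred 'I_n) w v :
  (forall u u', E u u' -> P u' -> P u) -> connect E w v -> P v -> P w.
Proof.
move=> clP /connectP[p pE ->]; elim: p w pE => //= u p IH w /andP[wu pE] Pl.
exact: clP wu (IH _ pE Pl).
Qed.

Lemma connect_sink x y : (forall u, ~~ E x u) -> connect E x y -> x = y.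
Proof.
move=> sx /connectP[[|u p] /=]; first by [].
by case/andP=> xu; move: (sx u); rewrite xu.
Qed.

Lemma rank_acyclic (r : 'I_n -> nat) :
  (forall u v, E u v -> r u < r v) -> acyclic E.
Proof.
move=> rE u v /rE ruv; apply/negP=> /connectP[p pE lp].
have : r v <= r (last v p).
  elim: p v pE {ruv lp} => //= w p IH v /andP[/rE vw /IH]; lia.
by rewrite -lp; lia.
Qed.

Hypothesis acE : acyclic E.

Lemma acyclic_connect_antisym u v : connect E u v -> connect E v u -> u = v.
Proof.
move=> cuv /connect_parent[->//|[w cvw wu]].
by move: (acE wu); rewrite (connect_trans cuv cvw).
Qed.

Lemma is_lca_sym x y w : is_lca E x y w -> is_lca E y x w.
Proof. by case=> wx wy low; split=> // w' ? ? ?; apply: low. Qed.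

(** A common ancestor of the sink [x] and another vertex [y] cannot be [x] itself, so it reaches [x]
    through the only parent [a]. Hence [a] lies below every common ancestor. *)
Lemma lca_pendant x y a :
  (forall u, E u x = (u == a)) -> (forall u, ~~ E x u) ->
  connect E a y -> x != y -> forall w, is_lca E x y w <-> w = a.
Proof.
move=> px sx ay neq_xy.
have ax : connect E a x by apply: connect1; rewrite px.
have above w : connect E w x -> connect E w y -> connect E w a.
  move=> /connect_parent[->|[u wu]]; last by rewrite px => /eqP <-.
  by move/(connect_sink sx)/eqP; rewrite (negbTE neq_xy).
move=> w; split=> [[wx wy low]|->]; first by rewrite (low a) ?above.
by split=> // w' wx wy aw'; apply: acyclic_connect_antisym; first exact: above.
Qed.

(* [v x] is the vertex carrying the leaf [f x]; the last entry of [s] may be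
   carried by itself, which covers the cherry of a caterpillar. *)
Lemma side_lca (T : eqType) (f v : T -> 'I_n) (x0 : T) (s : seq T) z :
  injective f -> uniq (rcons s z) -> sorted (relpre v E) (rcons s z) ->
  {in rcons s z, forall x : T, connect E (v x) (f x)} ->
  (forall (x : T) u, x \in s -> E u (f x) = (u == v x)) ->
  (forall (x : T) u, ~~ E (f x) u) ->
  forall i j w, i < j <= size s ->
    is_lca E (f (nth x0 (rcons s z) i)) (f (nth x0 (rcons s z) j)) w <->
      w = v (nth x0 (rcons s z) i).
Proof.
move=> injf us sE cv pf sf i j w /andP[ij js].
have szs : size (rcons s z) = (size s).+1 by rewrite size_rcons.
have isz : i < size s by apply: leq_trans js.
apply: lca_pendant => //.
- by move=> u; rewrite pf // nth_rcons isz mem_nth.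
- apply: (@connect_trans _ _ (v (nth x0 (rcons s z) j))); last first.
    by apply: cv; rewrite mem_nth // szs ltnS.
  have tr : transitive (relpre v (connect E)) by move=> ? ? ?; apply: connect_trans.
  apply: (sorted_ltn_nth tr); rewrite ?inE ?szs //; last by rewrite ltnS ltnW.
  by apply: sub_sorted sE => x' y' /=; apply: connect1.
- by rewrite (inj_eq injf) nth_uniq // ?szs // ?ltnS ?(ltnW isz) // neq_ltn ij.
Qed.

End Digraph.

Definition isl1 (a : label) : bool := if a is l1 then true else false.

Lemma isl1P a : reflect (a = l1) (isl1 a).
Proof. by case: a; constructor. Qed.

Lemma explains_lca (T : finType) (adj : rel T) n (E : rel 'I_n) X t f x y a :
  explains_via adj E X t f -> x != y ->
  (forall w, is_lca E (f x) (f y) w <-> w = a) -> adj x y = isl1 (t a).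
Proof.
case=> _ _ ex /ex exy lca; apply/idP/isl1P.
  by move/exy => [w [/lca ->]].
by move=> ta; apply/exy; exists a; split=> //; apply/lca.
Qed.

Lemma lca_explains (T : finType) (adj : rel T) n (E : rel 'I_n) t f
    (x y : T) a :
  (forall w, is_lca E (f x) (f y) w <-> w = a) -> adj x y = isl1 (t a) ->
  adj x y <-> exists w, is_lca E (f x) (f y) w /\ t w = l1.
Proof.
move=> lca ->; split=> [/isl1P ta|[w [/lca -> ta]]]; last exact/isl1P.
by exists a; split=> //; apply/lca.
Qed.

(** * Alternating sequences *)

(** Adjacency depends on the earlier position only, as in a caterpillar whose inner labels alternate
    downwards. The last entry is never the earlier one, so no bit is attached to it. *)
Definition alternating (T : eqType) (adj : rel T) (c : bool) (s : seq T) :=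
  forall x0 i j, i < j < size s ->
    adj (nth x0 s i) (nth x0 s j) = c (+) odd i.

Section Alternating.
Variables (T : eqType) (adj : rel T).
Implicit Types (s : seq T) (c : bool).

Lemma alternating_cons c x s :
  alternating adj c (x :: s) <->
  {in s, forall y, adj x y = c} /\ alternating adj (~~ c) s.
Proof.
split=> [alt|[cx alt] x0 [|i] [|j] //= ij].
- split=> [y ys|x0 i j ij].
    have := alt x 0 (index y s).+1; rewrite /= nth_index // addbF; apply.
    by rewrite ltnS index_mem.
  by rewrite (alt x0 i.+1 j.+1) //= addbN addNb.
- by rewrite addbF cx // mem_nth.
- by rewrite alt // addNb addbN.
Qed.

Lemma alternating_nil c : alternating adj c [::].
Proof. by move=> ? ? ? /andP[]. Qed.

Hypotheses (adj_sym : symmetric adj) (adj_irr : irreflexive adj).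

(** Every vertex of an induced $P_4$ has both a neighbour and a non-neighbour in it, whereas the
    head of the sequence is dominating or isolated. So the $P_4$ avoids the head, and induction
    handles the tail. *)
Lemma alternating_P4_free c s a b d e :
  alternating adj c s -> a \in s -> b \in s -> d \in s -> e \in s ->
  adj a b -> adj b d -> adj d e -> ~~ adj a d -> ~~ adj b e -> ~~ adj a e ->
  False.
Proof.
elim: s c => // x s IH c /alternating_cons[cx alt].
(* A single neighbour of [x] in the sequence forces [c] to be true. *)
have cx' y z : adj x z -> y != x -> z \in x :: s -> y \in x :: s -> adj x y.
  rewrite !inE => xz /negbTE -> /orP[/eqP zx|zs]; first by rewrite zx adj_irr in xz.
  by move=> ys; rewrite cx // -(cx _ zs).
move=> ha hb hd he ab bd de ad be ae.
have [ax|ax] := eqVneq a x.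
  subst a; have [dx|dx] := eqVneq d x; first by move: ae; rewrite -dx de.
  by move: ad; rewrite (cx' _ b).
have [bx|bx] := eqVneq b x.
  subst b; have [ex|ex] := eqVneq e x; first by move: ae; rewrite ex ab.
  by move: be; rewrite (cx' _ d).
have [dx|dx] := eqVneq d x.
  by subst d; move: ad; rewrite adj_sym (cx' _ e).
have [ex|ex] := eqVneq e x.
  by subst e; move: be; rewrite adj_sym (cx' _ d) // adj_sym.
move: ha hb hd he; rewrite !inE (negbTE ax) (negbTE bx) (negbTE dx) (negbTE ex).
by move=> ha hb hd he; apply: (IH (~~ c)) ab bd de ad be ae.
Qed.

End Alternating.

Lemma alternating_map (T T' : eqType) (h : T' -> T) (adj : rel T) c s :
  alternating (relpre h adj) c s <-> alternating adj c (map h s).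
Proof.
elim: s c => [|x s IH] c; first by split=> _; apply: alternating_nil.
rewrite map_cons !alternating_cons IH; split=> -[cx ?]; split=> //.
  by move=> _ /mapP[y ys ->]; apply: cx.
by move=> y ys; apply: cx; apply: map_f.
Qed.

(** If [c] holds, the first entry is the centre of a spanning star; otherwise it is isolated, and a
    second entry exists. *)
Lemma alternating_connected (T : finType) (adj : rel T) c s (A : {set T}) :
  symmetric adj -> irreflexive adj ->
  alternating adj c s -> uniq s -> 1 < size s -> s =i A ->
  connected_on adj A <-> c.
Proof.
move=> adj_sym adj_irr; case: s => [|x [|y s]] //.
move=> /alternating_cons[cx _] us _ sA.
have xA : x \in A by rewrite -sA mem_head.
set R := [rel a b | [&& adj a b, a \in A & b \in A]].
have symR : connect_sym R.
  by apply: sym_connect_sym => a b; rewrite /= adj_sym [(a \in A) && _]andbC.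
split=> [con|cT].
  have yA : y \in A by rewrite -sA !inE eqxx orbT.
  have /connectP[[|z p] /=] := con _ _ xA yA.
    by move=> _ yx; move: us; rewrite yx /= mem_head.
  case/andP=> /and3P[xz _ zA] _ _; move: zA; rewrite -sA inE.
  case/orP=> [/eqP zx|/cx <- //]; by rewrite zx adj_irr in xz.
have cen z : z \in A -> connect R x z.
  rewrite -sA inE => /orP[/eqP -> //|zs].
  by apply: connect1; rewrite /R /= cx // cT xA -sA inE zs orbT.
by move=> u z /cen xu /cen; apply: connect_trans; rewrite symR.
Qed.

(** * From caterpillars to alternating sequences *)

Lemma path_alternate (V : Type) (b : V -> bool) x s :
  path (fun u v => b u != b v) x s ->
  forall x0 i, i <= size s -> b (nth x0 (x :: s) i) = b x (+) odd i.
Proof.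
elim: s x => [|y s IH] x /= => [_ x0 []|/andP[bxy pb] x0 [_|i le_is]] //=.
- by rewrite addbF.
- by rewrite addbF.
have /= -> := IH y pb x0 i le_is.
by rewrite addbN -addNb; congr (_ (+) _); case: (b x) (b y) bxy => -[].
Qed.

Lemma isl1_neq n (X : {set 'I_n}) t u v : labeling X t ->
  u \notin X -> v \notin X -> t u <> t v -> isl1 (t u) != isl1 (t v).
Proof.
move=> lab uX vX; have : t u <> lodot by move/lab; apply/negP.
have : t v <> lodot by move/lab; apply/negP.
by case: (t u) (t v) => -[].
Qed.

(** Labels are prescribed only for the carriers of [s]: the carrier of [z], a leaf in a caterpillar
    and the hybrid vertex in a network, is never the lca of two entries. *)
Lemma side_alternating (T : finType) (adj : rel T) n (E : rel 'I_n) X t f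
    (v : T -> 'I_n) (s : seq T) z c :
  acyclic E -> explains_via adj E X t f ->
  uniq (rcons s z) -> sorted (relpre v E) (rcons s z) ->
  {in rcons s z, forall x : T, connect E (v x) (f x)} ->
  (forall (x : T) u, x \in s -> E u (f x) = (u == v x)) ->
  (forall (x : T) u, ~~ E (f x) u) ->
  (forall x0 i, i < size s -> isl1 (t (v (nth x0 s i))) = c (+) odd i) ->
  alternating adj c (rcons s z).
Proof.
move=> acE ex us sE cv pf sf lab x0 i j; rewrite size_rcons ltnS => /andP[ij js].
have [injf _ _] := ex.
have isz : i < size s by apply: leq_trans js.
have neq : nth x0 (rcons s z) i != nth x0 (rcons s z) j.
  by rewrite nth_uniq ?size_rcons // ?ltnS 1?ltnW // neq_ltn ij.
rewrite (explains_lca ex neq (a := v (nth x0 (rcons s z) i))).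
  by rewrite nth_rcons isz lab.
by move=> w; apply: (side_lca acE x0 injf us sE cv pf sf); rewrite ij.
Qed.

Lemma card2_third (V : finType) (A : {set V}) a b d :
  #|A| = 2 -> a \in A -> b \in A -> d \in A -> a != b -> d = a \/ d = b.
Proof.
move=> A2 aA bA dA ab; have : [set a; b] == A.
  by rewrite eqEcard A2 cards2 ab leqnn andbT subUset !sub1set aA.
by move/eqP=> eA; move: dA; rewrite -eA => /set2P.
Qed.

Lemma indeg1_parent n (E : rel 'I_n) u u' x :
  indeg E x <= 1 -> E u x -> E u' x -> u = u'.
Proof. by move=> /card_le1_eqP le1 ux u'x; apply: le1; rewrite inE. Qed.

Lemma indeg0_parent n (E : rel 'I_n) u x : indeg E x = 0 -> ~~ E u x.
Proof. by move/cards0_eq/setP/(_ u); rewrite !inE => ->. Qed.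

Lemma outdeg0_sink n (E : rel 'I_n) x u : outdeg E x = 0 -> ~~ E x u.
Proof. by move/cards0_eq/setP/(_ u); rewrite !inE => ->. Qed.

Lemma indeg_gt0 n (E : rel 'I_n) x : 0 < indeg E x -> exists u, E u x.
Proof. by case/card_gt0P=> u; rewrite inE; exists u. Qed.

Lemma network_sink n (E : rel 'I_n) X x u : network E X -> x \in X ->
  ~~ E x u.
Proof.
case=> acE [[XT X1]|[rho [_ _ _ N2 _]] /N2[/outdeg0_sink //]].
move=> _; apply/negP=> xu; have : x = u.
  by apply: (card_le1_eqP (eq_leq X1)); rewrite XT inE.
by move=> eq_xu; move: (acE _ _ xu); rewrite eq_xu connect0.
Qed.

(** List the spine from the root, followed by [f w]. Each spine vertex has one child in this list
    and one further child, a leaf; these leaves in order, then [w], form the sequence. *)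
Lemma cat_cotree_alternating (T : finType) (adj : rel T) n (E : rel 'I_n) X t
    (f : T -> 'I_n) w :
  cat_cotree adj E X t f -> in_cherry E X (f w) ->
  exists c s, [/\ s != [::], uniq (rcons s w), (forall x, x \in rcons s w) &
                  alternating adj c (rcons s w)].
Proof.
case=> -[netE in1] lab dis ex [_ [out2 [rho [p [rho0 uP inP adjP]]]]] cher.
have [injf fX _] := ex; have acE : acyclic E by case: netE.
have rhoX : rho \notin X by rewrite -inP mem_head.
have sinkf x u : ~~ E (f x) u.
  by apply: (network_sink _ netE); apply/fX; exists x.
have parent x : exists u, E u (f x).
  have fxX : f x \in X by apply/fX; exists x.
  case: netE => _ [[XT _]|[_ [_ _ _ N2 _]]]; first by rewrite XT inE in rhoX.
  by case/N2: fxX => _ fx1; apply: indeg_gt0; rewrite fx1.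
have par u u' x : E u x -> E u' x -> u = u' by apply: indeg1_parent.
have innerP u x : E u x -> u \in rho :: p.
  by move=> ux; rewrite inP; apply/negP=> /fX[y yu]; move: (sinkf y x); rewrite yu ux.
(* Spine adjacency leaves directions open. Nothing enters the root, and a backward edge would give a
   spine vertex a second parent besides its predecessor. *)
have pE : path E rho p.
  apply/(pathP rho); elim=> [|i IH] lt_ip.
    have /adjP : nth rho (rho :: p) 0 \notin X by [].
    move/(_ (nth rho p 0)); rewrite -inP inE mem_nth ?orbT // => /(_ isT)[_ adj01].
    have /orP[//|] : E rho (nth rho p 0) || E (nth rho p 0) rho.
      by apply: adj01; left; exists 0; split=> //=; apply: set_nth_default.
    by rewrite (negbTE (indeg0_parent _ rho0)).
  have /orP[//|back] : E (nth rho p i) (nth rho p i.+1) || E (nth rho p i.+1) (nth rho p i).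
    apply/adjP; rewrite -?inP ?inE ?mem_nth ?orbT // 1?ltnW //.
    by left; exists i.+1; split=> //=; apply: set_nth_default => //; apply: ltnW.
  have /= := IH (ltnW lt_ip); move/par/(_ back)/eqP.
  have -> : nth rho p i.+1 = nth rho (rho :: p) i.+2 by [].
  by rewrite nth_uniq //= ?ltnS; lia.
case: cher => zX [u' [q [u'X neq_u'z qz qu']]].
(* Otherwise the next spine vertex would be a third child of [q] beside the two leaves of the
   cherry. *)
have lastq : q = last rho p.
  have qP := innerP _ _ qz; have := nth_index rho qP.
  have : index q (rho :: p) < size (rho :: p) by rewrite index_mem.
  move: (index q _) => i /=; rewrite ltnS leq_eqVlt => /orP[/eqP -> <-|lt_ip eq_q].
    by rewrite -last_nth.
  have /(pathP rho)/(_ i lt_ip) := pE; rewrite eq_q => qn.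
  have nX : nth rho p i \notin X by rewrite -inP inE mem_nth ?orbT.
  have := @card2_third _ [set v | E q v] (f w) u' (nth rho p i).
  rewrite !inE qz qu' qn eq_sym neq_u'z => -[] //.
  - by apply: out2; rewrite -inP.
  - by move=> e; rewrite e zX in nX.
  - by move=> e; rewrite e u'X in nX.
have WE : path E rho (rcons p (f w)) by rewrite rcons_path pE -lastq.
have zW : f w \notin rho :: p by rewrite inP negbK.
have uW : uniq (rho :: rcons p (f w)) by rewrite -rcons_cons rcons_uniq zW.
set W := rho :: rcons p (f w) in uW.
have WP u : (u \in W) = (u == f w) || (u \in rho :: p).
  by rewrite /W -rcons_cons mem_rcons inE.
have spine u : u \in rho :: p ->
    exists cc, [/\ cc \in W, E u cc & forall d, d \in W -> E u d -> d = cc].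
  move=> uP'; have lt_ip : index u (rho :: p) < size (rho :: p) by rewrite index_mem.
  have eq_u := nth_index rho uP'; move: (index u _) lt_ip eq_u => i /= lt_ip eq_u.
  have WEi j : j <= size p -> E (nth rho W j) (nth rho W j.+1).
    by move=> lt_jp; have /(pathP rho) := WE; apply; rewrite size_rcons.
  have eq_Wu : nth rho W i = u by rewrite /W -rcons_cons nth_rcons /= lt_ip.
  exists (nth rho W i.+1); split.
  - by rewrite mem_nth //= size_rcons.
  - by rewrite -{1}eq_Wu WEi.
  - move=> d dW; have := nth_index rho dW.
    have : index d W < size W by rewrite index_mem.
    move: (index d W) => [|j]; rewrite /= ?size_rcons => lt_j <- ud.
      by move: ud; rewrite (negbTE (indeg0_parent _ rho0)).
    have /eqP := par _ _ _ ud (WEi j lt_j).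
    rewrite -eq_Wu nth_uniq //= ?size_rcons => [/eqP -> //||]; by rewrite ltnS 1?ltnW.
have leafP u : u \in rho :: p -> exists x, E u (f x) && (x != w).
  move=> uP'; have [cc [ccW ucc only]] := spine u uP'.
  have : #|[set v | E u v]| == 2 by apply/eqP/out2; rewrite -inP.
  case/cards2P=> [c1 [c2 [neq12 ec]]].
  have [d [ud dcc]] : exists d, E u d /\ d != cc.
    have := ucc; have : E u c1 /\ E u c2.
      by split; [have := set21 c1 c2|have := set22 c1 c2]; rewrite -ec inE.
    case=> uc1 uc2 _; have [e|] := eqVneq c1 cc; last by exists c1.
    by exists c2; rewrite -e eq_sym.
  have : d \notin W by apply: contra dcc => /only/(_ ud)/eqP.
  rewrite WP negb_or inP negbK => /andP[dw /fX[x fx]].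
  by exists x; rewrite fx ud; apply: contra dw => /eqP <-; rewrite fx.
have offW x : x != w -> f x \notin W.
  move=> xw; rewrite WP (inj_eq injf) (negbTE xw) inP negbK.
  by apply/fX; exists x.
have leaf_uniq u x y : E u (f x) -> x != w -> E u (f y) -> y != w -> x = y.
  move=> ux xw uy yw; have uP' := innerP _ _ ux.
  have [cc [ccW ucc _]] := spine u uP'.
  have := @card2_third _ [set v | E u v] (f x) cc (f y); rewrite !inE ux ucc uy.
  case=> //; first by apply: out2; rewrite -inP.
  - by apply: contraNneq (offW _ xw) => ->.
  - by move/injf.
  - by move=> e; move: (offW _ yw); rewrite e ccW.
(* The default [w] matters: [f w] is a sink, so [g (f w) = w] and [g] can be mapped over all of
   [W]. *)
pose g u := odflt w [pick x | E u (f x) && (x != w)].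
have gP u : u \in rho :: p -> E u (f (g u)) /\ g u != w.
  move=> /leafP[x ux]; rewrite /g; case: pickP => [y /andP[]//|/(_ x)].
  by rewrite ux.
have gz : g (f w) = w.
  by rewrite /g; case: pickP => // y /andP[]; rewrite (negbTE (sinkf _ _)).
have gE u x : E u (f x) -> x != w -> g u = x.
  move=> ux xw; have [ug gw] := gP _ (innerP _ _ ux).
  exact: leaf_uniq ug gw ux xw.
(* The parent of the leaf [f x], except that [w] is carried by its own leaf; thus [v] undoes [g] on
   [W]. *)
pose v x := if x == w then f w else odflt rho [pick u | E u (f x)].
have vE x u : x != w -> E u (f x) = (u == v x).
  move=> xw; rewrite /v (negbTE xw); case: pickP => [u0 u0x|none] /=.
    by apply/idP/eqP=> [/par/(_ u0x)|->].
  by case: (parent x) => u1; rewrite none.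
have vg u : u \in W -> v (g u) = u.
  rewrite WP => /orP[/eqP ->|/gP[ug gw]]; first by rewrite gz /v eqxx.
  by apply/eqP; rewrite eq_sym -vE.
have mapW : map g W = rcons (map g (rho :: p)) w.
  by rewrite /W -rcons_cons map_rcons gz.
have vin x : x \in map g (rho :: p) -> x != w.
  by case/mapP=> u /gP[_ ?] ->.
(* The root carries the first leaf, so its label is the initial bit. *)
exists (isl1 (t rho)), (map g (rho :: p)); rewrite -mapW; split=> //.
- by rewrite map_inj_in_uniq // => a b aW bW /(congr1 v); rewrite !vg.
- move=> x; have [->|xw] := eqVneq x w; first by rewrite mapW mem_rcons mem_head.
  have [u ux] := parent x; apply/mapP; exists u; last by rewrite (gE u x).
  by rewrite WP (innerP _ _ ux) orbT.
- rewrite mapW; apply: (side_alternating (v := v) acE ex) => //.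
+ rewrite -mapW map_inj_in_uniq // => a b aW bW /(congr1 v); by rewrite !vg.
+ rewrite -mapW sorted_map; have WS : sorted E W := WE.
  apply: (sub_in_sorted (P := fun u => u \in W)) WS; last exact/allP.
  by move=> a b /= aW bW ab; rewrite !vg.
+ move=> x _; rewrite /v; case: eqP => [->|/eqP xw]; first exact: connect0.
  by apply: connect1; move: (vE x (v x) xw); rewrite /v (negbTE xw) eqxx.
+ by move=> x u /vin xw; apply: vE.
+ move=> x0 i; rewrite size_map => lt_ip; rewrite (nth_map rho) // vg; last first.
    by rewrite WP mem_nth ?orbT.
  apply: (path_alternate (b := fun u => isl1 (t u))); last by move: lt_ip; rewrite /= ltnS.
  have PX : all (fun u => u \notin X) (rho :: p).
    by apply/allP=> u; rewrite inP.
  apply: (sub_in_path (P := fun u => u \notin X)) pE; last exact: PX.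
  by move=> a b aX bX ab; apply: (isl1_neq lab) => //; apply: dis.
Qed.

(** * From alternating sequences to caterpillars *)

Lemma side_explains (T : finType) (adj : rel T) n (E : rel 'I_n) t
    (f v : T -> 'I_n) (s : seq T) z c :
  symmetric adj -> acyclic E -> injective f ->
  uniq (rcons s z) -> sorted (relpre v E) (rcons s z) ->
  {in rcons s z, forall x : T, connect E (v x) (f x)} ->
  (forall (x : T) u, x \in s -> E u (f x) = (u == v x)) ->
  (forall (x : T) u, ~~ E (f x) u) ->
  (forall x0 i, i < size s -> isl1 (t (v (nth x0 s i))) = c (+) odd i) ->
  alternating adj c (rcons s z) ->
  {in rcons s z &, forall x y : T, x != y ->
    (adj x y <-> exists w, is_lca E (f x) (f y) w /\ t w = l1)}.
Proof.
move=> adj_sym acE injf us sE cv pf sf lab alt x y xs ys xy.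
wlog lt_xy : x y xs ys xy / index x (rcons s z) < index y (rcons s z).
  move=> IH; have [lt|gt|eq_i] := ltngtP (index x (rcons s z)) (index y (rcons s z)).
  - exact: IH.
  - rewrite adj_sym (IH y x) // 1?eq_sym //.
    by split=> -[w [/is_lca_sym lca tw]]; exists w.
  - by rewrite -(nth_index x xs) eq_i nth_index ?eqxx in xy.
have := nth_index x xs; have := nth_index x ys.
have : index y (rcons s z) < size (rcons s z) by rewrite index_mem.
move: (index x _) (index y _) lt_xy => i j ij; rewrite size_rcons ltnS => js ey ex.
have isz : i < size s by apply: leq_trans js.
have lca w := @side_lca _ _ acE T f v x s z injf us sE cv pf sf i j w.
rewrite ex ey in lca; apply: lca_explains.
  by move=> w; apply: lca; rewrite ij.
have := alt x i j; rewrite size_rcons ltnS ij ex ey => -> //.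
by rewrite -ex nth_rcons isz lab.
Qed.

Lemma card_set_eq0 (V : finType) (P : pred V) :
  (forall u, ~~ P u) -> #|[set u | P u]| = 0.
Proof. by move=> P0; apply: eq_card0 => u; rewrite inE (negbTE (P0 u)). Qed.

Lemma card_set_eq1 (V : finType) (P : pred V) a :
  (forall u, P u = (u == a)) -> #|[set u | P u]| = 1.
Proof. by move=> Pa; rewrite -(cards1 a); apply: eq_card => u; rewrite !inE Pa. Qed.

Lemma card_set_eq2 (V : finType) (P : pred V) a b :
  a != b -> (forall u, P u = (u == a) || (u == b)) -> #|[set u | P u]| = 2.
Proof.
move=> ab Pab; have := cards2 a b; rewrite ab => <-.
by apply: eq_card => u; rewrite !inE Pab.
Qed.

Section CaterpillarNetwork.
Variables (m : nat) (c : bool).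
Hypothesis m_gt0 : 0 < m.
Local Notation n := (m + m).+1.

(* Spine [0 .. m-1]; the leaf [m + i] hangs from [i], and [m + m] is the second
   leaf of the cherry. *)
Definition cat_edge : rel 'I_n := fun i j =>
  (i < m) && [|| (j < m) && (j == i.+1 :> nat), j == m + i :> nat |
                 (i.+1 == m) && (j == m + m :> nat)].
Definition cat_leaves : {set 'I_n} := [set i : 'I_n | m <= i].
Definition cat_label (i : 'I_n) : label :=
  if m <= i then lodot else if c (+) odd i then l1 else l0.

Lemma cat_edge_acyclic : acyclic cat_edge.
Proof. by apply: (@rank_acyclic _ _ (@nat_of_ord _)) => u v; rewrite /cat_edge; lia. Qed.

Lemma eq_inord_ord k (u : 'I_n) : k < n -> (u == inord k) = (u == k :> nat).
Proof. by move=> kn; rewrite -val_eqE /= inordK. Qed.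

Lemma cat_indeg0 : indeg cat_edge ord0 = 0.
Proof. by apply: card_set_eq0 => u; rewrite /cat_edge /=; lia. Qed.

Lemma cat_indeg1 (v : 'I_n) : v != ord0 -> indeg cat_edge v = 1.
Proof.
move=> v0; have {}v0 : 0 < v by rewrite lt0n; apply: contra v0 => /eqP v0; apply/eqP/val_inj.
have := ltn_ord v; move=> vn.
pose p := if v < m then v.-1 else if v == m + m :> nat then m.-1 else v - m.
apply: (@card_set_eq1 _ _ (inord p)) => u; rewrite eq_inord_ord; last first.
  by rewrite /p; do ?case: ifP; lia.
by rewrite /cat_edge /p; do ?case: ifP; lia.
Qed.

Lemma cat_outdeg2 (u : 'I_n) : u < m -> outdeg cat_edge u = 2.
Proof.
move=> um; pose d := if u.+1 < m then u.+1 else m + m.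
have ud : u.+1 < m /\ d = u.+1 \/ u.+1 = m /\ d = m + m.
  by rewrite /d; case: ltnP; lia.
apply: (@card_set_eq2 _ _ (inord (m + u)) (inord d)) => [|v].
  by rewrite eq_inord_ord ?inordK; lia.
by have := ltn_ord v; rewrite !eq_inord_ord /cat_edge; lia.
Qed.

Lemma cat_outdeg0 (u : 'I_n) : m <= u -> outdeg cat_edge u = 0.
Proof. by move=> mu; apply: card_set_eq0 => v; rewrite /cat_edge; lia. Qed.

Lemma cat_network : network cat_edge cat_leaves.
Proof.
split; first exact: cat_edge_acyclic.
right; exists ord0; split.
- exact: cat_indeg0.
- by rewrite cat_outdeg2.
- by move=> v v0; apply/eqP/negPn/negP=> /cat_indeg1; rewrite v0.
- move=> x; rewrite inE; split=> [mx|[x0 _]].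
    by rewrite cat_outdeg0 // cat_indeg1 // -val_eqE /=; lia.
  by rewrite leqNgt; apply/negP=> /cat_outdeg2; rewrite x0.
- move=> v v0; rewrite inE -ltnNge => vm; left.
  by rewrite cat_indeg1 // cat_outdeg2.
Qed.

Lemma cat_tree : tree cat_edge cat_leaves.
Proof.
split=> [|v]; first exact: cat_network.
by have [->|/cat_indeg1 ->] := eqVneq v ord0; rewrite ?cat_indeg0.
Qed.

Lemma cat_caterpillar : caterpillar cat_edge cat_leaves.
Proof.
split; first exact: cat_tree.
split=> [u|]; first by rewrite inE -ltnNge; apply: cat_outdeg2.
pose P : seq 'I_n := map inord (iota 0 m).
have eP : P = ord0 :: map inord (iota 1 m.-1).
  have -> : P = map inord (0 :: iota 1 m.-1) by rewrite /P; congr map; case: (m) m_gt0.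
  by rewrite map_cons; congr cons; apply: val_inj; rewrite /= inordK.
have szP : size P = m by rewrite size_map size_iota.
have nthP x i : i < m -> nth x P i = inord i.
  by move=> im; rewrite (nth_map 0) ?size_iota // nth_iota.
have vP i : i < m -> (inord i : 'I_n) = i :> nat.
  by move=> im; rewrite inordK //; lia.
exists ord0, (map inord (iota 1 m.-1)); rewrite -eP; split.
- exact: cat_indeg0.
- rewrite map_inj_in_uniq ?iota_uniq // => i j; rewrite !mem_iota /= => im jm.
  by move/(congr1 val); rewrite /= !vP.
- move=> u; rewrite inE -ltnNge; apply/mapP/idP=> [[i]|um].
    by rewrite mem_iota => /= im ->; rewrite vP.
  by exists (u : nat); [rewrite mem_iota | rewrite inord_val].
have consecP (u v : 'I_n) : consec P u v <-> v < m /\ v = u.+1 :> nat.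
  split=> [[i []]|[vm vu]].
    rewrite szP => im; have im' := ltnW im.
    by rewrite !nthP // => <- <-; rewrite !vP.
  have um : u < m by lia.
  by exists u; rewrite szP -vu vm !nthP // !inord_val.
move=> u v; rewrite !inE -!ltnNge => um vm; rewrite !consecP /cat_edge; lia.
Qed.

End CaterpillarNetwork.

(** The entry at position [i] becomes the leaf [m + i]. Thus [w], at position [m], is the extra leaf
    and shares its parent with the last entry of [s]. *)
Lemma alternating_cat_cotree (T : finType) (adj : rel T) c s w :
  symmetric adj -> s != [::] -> uniq (rcons s w) ->
  (forall x, x \in rcons s w) -> alternating adj c (rcons s w) ->
  exists n (E : rel 'I_n) X t (f : T -> 'I_n),
    cat_cotree adj E X t f /\ in_cherry E X (f w).
Proof.
move=> adj_sym s0 us cov alt; set m := size s.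
have m0 : 0 < m by rewrite lt0n size_eq0.
pose S := rcons s w.
have idx x : index x S <= m by rewrite -ltnS -(size_rcons s w) index_mem.
pose f x : 'I_(m + m).+1 := inord (m + index x S).
have fE x : f x = m + index x S :> nat.
  by rewrite inordK // ltnS leq_add2l.
have injf : injective f.
  move=> x y /(congr1 val); rewrite /= !fE => /addnI e.
  by rewrite -(nth_index w (cov x)) -/S e nth_index.
have ws : w \notin s by move: us; rewrite rcons_uniq => /andP[].
have iw : index w S = m by rewrite /S -cats1 index_cat (negbTE ws) /= eqxx addn0.
have is_ x : x \in s -> index x S < m.
  by move=> xs; rewrite /S -cats1 index_cat xs index_mem.
pose v x : 'I_(m + m).+1 := if x == w then f w else inord (index x S).
have vs x : x \in s -> v x = index x S :> nat.
  move=> xs; rewrite /v; case: eqP => [xw|_]; first by rewrite -xw xs in ws.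
  by rewrite inordK //; have := idx x; lia.
have inX x : f x \in cat_leaves m by rewrite inE fE leq_addr.
exists _, (@cat_edge m), (cat_leaves m), (@cat_label m c), f; split; last first.
  split=> //; pose y := nth w s m.-1.
  have ys : y \in s by rewrite mem_nth // /m; lia.
  have iy : index y S = m.-1.
    by rewrite /S -cats1 index_cat ys index_uniq //; [lia|move: us; rewrite rcons_uniq => /andP[]].
  exists (f y), (inord m.-1); rewrite (inj_eq injf); split=> //.
  - by apply: contraNneq ws => <-.
  - rewrite /cat_edge !fE iw inordK; lia.
  - rewrite /cat_edge !fE iy inordK; lia.
split; [exact: cat_tree| | | |exact: cat_caterpillar].
- move=> u; rewrite inE /cat_label; case: leqP => //= _; split=> //.
  by case: ifP.
- move=> u u'; rewrite !inE /cat_label -!ltnNge /cat_edge => uu' um um'.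
  have eu' : u' = u.+1 :> nat by lia.
  rewrite !(leqNgt m) um um' eu' [odd _]/= addbN.
  by case: (c (+) odd u).
split=> // [u|x y xy].
  split=> [|[x <-] //]; rewrite inE => mu.
  have um : u - m < size S by rewrite size_rcons -/m; have := ltn_ord u; lia.
  exists (nth w S (u - m)); apply: val_inj; rewrite /= fE index_uniq //; lia.
apply: (side_explains (v := v) (s := s) (z := w) (c := c)) => //.
- exact: cat_edge_acyclic.
- apply/(sortedP w) => i; rewrite size_rcons ltnS -/m -/S => im.
  have i1 : index (nth w S i) S = i by rewrite index_uniq // size_rcons ltnS ltnW.
  have i2 : index (nth w S i.+1) S = i.+1 by rewrite index_uniq // size_rcons ltnS.
  have e1 : v (nth w S i) = i :> nat.
    by rewrite vs // /S nth_rcons im mem_nth.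
  rewrite /= /cat_edge e1 im /=.
  have [im'|] := ltnP i.+1 m.
    by rewrite vs ?i2 ?im' ?eqxx // /S nth_rcons im' mem_nth.
  move=> mi; have -> : nth w S i.+1 = w.
    by rewrite /S nth_rcons ltnNge mi /= -/m; case: eqP => //; lia.
  by rewrite /v eqxx fE iw; lia.
- move=> z _; rewrite /v; case: eqP => [-> //|/eqP zw].
  have zs : z \in s by move: (cov z); rewrite mem_rcons inE (negbTE zw).
  have lt_zm := is_ _ zs; apply: connect1; rewrite /cat_edge fE inordK; lia.
- move=> z u zs; rewrite -val_eqE /= vs // /cat_edge fE.
  by have := is_ _ zs; lia.
- by move=> z u; rewrite /cat_edge fE; lia.
- move=> x0 i im; have zs : nth x0 s i \in s by rewrite mem_nth.
  have ii : index (nth x0 s i) S = i.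
    by rewrite /S -cats1 index_cat zs index_uniq //; move: us; rewrite rcons_uniq => /andP[].
  by rewrite /cat_label vs // ii leqNgt im /=; case: (c (+) _).
Qed.

(** * From elementary networks to alternating sequences *)

(* Indegree 2 forces both cycle edges at [h] to enter [h]; going back from [h]
   to [rho], every vertex needs a parent, which must be its predecessor. *)
Lemma cycle_forward n (E : rel 'I_n) (rho h : 'I_n) sa sb (s := rho :: sa ++ h :: sb) :
  acyclic E -> uniq s ->
  (forall u v, u \in s -> v \in s ->
     (E u v || E v u) = ((next s u == v) || (next s v == u))) ->
  (forall u v, v \in s -> E u v -> u \in s) ->
  (forall v, v \in s -> v != rho -> exists u, E u v) ->
  indeg E h = 2 ->
  path E rho (rcons sa h) /\
  {in sa, forall a, exists2 p, p \in rho :: sa & forall u, E u a -> u = p}.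
Proof.
move=> acE us adjE parC parE h2; set k := size sa.
(* The default [rho] makes the numbering wrap around: [S M] is again [S 0], so [next] is the shift
   by one at the last entry too. *)
pose S i := nth rho s i; pose M := size s.
have MkE : M = (k + size sb).+2 by rewrite /M /s /= size_cat /= addnS.
have M0 : 0 < M by [].
have nextS i : i < M -> next s (S i) = S i.+1.
  by move=> iM; rewrite next_nth mem_nth // index_uniq.
have Sinj i j : i < M -> j < M -> S i = S j -> i = j.
  by move=> iM jM /eqP; rewrite nth_uniq // => /eqP.
have Sprev i j : i < M -> 0 < j < M -> S i.+1 = S j -> S i = S j.-1.
  move=> iM /andP[j0 jM]; have [iM1|Mi] := ltnP i.+1 M.
    by move/(Sinj _ _ iM1 jM) <-.
  rewrite {1}/S nth_default // => /(Sinj 0 j M0 jM) j0'.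
  by rewrite -j0' in j0.
have Sin i : i < M -> S i \in s by apply: mem_nth.
have Sh : S k.+1 = h by rewrite /S /s /= nth_cat ltnn subnn.
have Sa i : i < k -> S i.+1 = nth rho sa i by move=> ik; rewrite /S /s /= nth_cat ik.
have kM : k.+1 < M by rewrite MkE; lia.
have parS j p : 0 < j < M -> E p (S j) -> p = S j.-1 \/ p = S j.+1.
  move=> jM pj; have [j0 jM'] := andP jM.
  have ps : p \in s by apply: parC pj; apply: Sin.
  have := adjE p (S j) ps (Sin _ jM'); rewrite pj orTb nextS //.
  case/esym/orP=> /eqP e; last by right.
  have [q qM eq_p] : exists2 q, q < M & S q = p.
    by exists (index p s); rewrite ?index_mem // /S nth_index.
  by left; move: e; rewrite -eq_p nextS //; apply: Sprev.
have Ek : E (S k) h.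
  have : [set u | E u h] \subset [set S k; S k.+2].
    apply/subsetP=> u; rewrite !inE -Sh => /parS[]; first by rewrite kM.
      by move=> ->; rewrite eqxx.
    by move=> ->; rewrite eqxx orbT.
  move=> sub; have := eqEcard [set u | E u h] [set S k; S k.+2].
  rewrite sub -/(indeg E h) h2 cards2 ltnS leq_b1 => /eqP e.
  by have := set21 (S k) (S k.+2); rewrite -e inE.
(* Walking back from [h]: [S i.+1] has some parent, and it is not [S i.+2], because the edge from
   [S i.+1] to that vertex is already known. *)
have Eback d : d <= k -> E (S (k - d)) (S (k - d).+1).
  elim: d => [|d IH] dk; first by rewrite subn0 Sh.
  have := IH (ltnW dk); have -> : k - d = (k - d.+1).+1 by lia.
  move: (k - d.+1) (leq_subr d.+1 k) => i ik Ei.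
  have iM : i.+1 < M by lia.
  have [||p Ep] := parE (S i.+1); first exact: Sin.
    by apply/eqP => /(Sinj i.+1 0 iM M0).
  have [|e|e] := parS _ _ _ Ep; first by rewrite iM.
    by rewrite -[S i]e.
  by have := acE _ _ Ei; rewrite -e connect1.
have Efwd i : i <= k -> E (S i) (S i.+1).
  by move=> ik; rewrite -(subKn ik); apply: Eback; apply: leq_subr.
split.
  apply/(pathP rho) => i; rewrite size_rcons ltnS => ik.
  have -> : nth rho (rcons sa h) i = S i.+1.
    by rewrite /S /s /= -cat_rcons nth_cat size_rcons ltnS ik.
  have -> : nth rho (rho :: rcons sa h) i = S i; last exact: Efwd.
  by rewrite /S /s -cat_rcons -cat_cons nth_cat /= size_rcons ltnS ltnW.
move=> a asa; have ik : index a sa < k by rewrite index_mem.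
have ea : S (index a sa).+1 = a by rewrite Sa // nth_index.
move: (index a sa) ik ea => i ik ea; exists (S i).
  by case: i ik {ea} => [|i] ik; rewrite inE ?eqxx // Sa ?mem_nth ?orbT // ltnW.
move=> u; rewrite -ea => ua; have iM : 0 < i.+1 < M by apply: leq_trans kM; apply: ltnW.
have [//|e] := parS _ _ iM ua.
by have := acE _ _ (Efwd _ ik); rewrite -e connect1.
Qed.

(** The hybrid vertex cuts the cycle into two sides, and [cycle_forward] applies to the cycle read
    in either direction. Within a side the lca is the upper carrier; across sides it is the root. *)
Lemma elementary_alternating (T : finType) (adj : rel T) n (E : rel 'I_n) X t
    (f : T -> 'I_n) :
  network E X -> elementary E X -> labeling X t -> quasi_discriminating E X t ->
  explains_via adj E X t f ->
  exists c h sa sb,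
    [/\ uniq (h :: sa ++ sb), forall x : T, x \in h :: sa ++ sb,
        0 < size (sa ++ sb),
        alternating adj c (rcons sa h) /\ alternating adj c (rcons sb h) &
        {in sa & sb, forall a b, adj a b = ~~ c}].
Proof.
move=> netE [C [rho [h [s0 [l]]]]].
case=> -[CX _] [rhoC rho0 hC h2] [us0 s3 s0C adjE] sinkX [lE lX linj lsurj].
move=> lab qd ex; have [injf fX _] := ex; have acE : acyclic E by case: netE.
have inC u : (u \in C) = (u \notin X) by rewrite CX inE.
have parE v : v \in C -> v != rho -> exists u, E u v.
  move=> _ vrho; apply: indeg_gt0; rewrite lt0n; apply: contra vrho => /eqP v0.
  case: netE => _ [[XT _]|[rho' [_ _ root _ _]]].
    by move: rhoC; rewrite inC XT inE.
  by rewrite (root v) // (root rho).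
have parC u v : v \in C -> E u v -> u \in C.
  by move=> _ uv; rewrite inC; apply/negP=> /sinkX; move/(_ v); rewrite uv.
have [i0 s1 rots] := @rot_to _ s0 rho (etrans (s0C rho) rhoC).
have hrho : h != rho by apply/eqP=> e; move: h2; rewrite /hybrid e rho0.
have s1C u : (u \in rho :: s1) = (u \in C) by rewrite -rots mem_rot s0C.
have us1 : uniq (rho :: s1) by rewrite -rots rot_uniq.
have adj1 u v : u \in C -> v \in C ->
    (E u v || E v u) = (next (rho :: s1) u == v) || (next (rho :: s1) v == u).
  by move=> uC vC; rewrite adjE // -rots !next_rot.
have size1 : 2 <= size s1 by move: s3; rewrite -(size_rot i0) rots.
have : h \in s1 by have := s1C h; rewrite hC inE (negbTE hrho).
case/splitPr e1 : {-}s1 / => [sa sb].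
rewrite e1 in s1C us1 adj1 size1.
(* Reversing the cycle and rotating by one puts [rho] first again, now with the other side leading
   to [h]. *)
have er : rho :: rev sb ++ h :: rev sa = rotr 1 (rev (rho :: sa ++ h :: sb)).
  by rewrite rev_cons rotr1_rcons rev_cat rev_cons cat_rcons.
have us2 : uniq (rho :: rev sb ++ h :: rev sa) by rewrite er rotr_uniq rev_uniq.
have s2C u : (u \in rho :: rev sb ++ h :: rev sa) = (u \in C).
  by rewrite er mem_rotr mem_rev s1C.
have [pa para] : path E rho (rcons sa h) /\
    {in sa, forall a, exists2 p, p \in rho :: sa & forall u, E u a -> u = p}.
  apply: (@cycle_forward _ _ _ _ _ sb) => // [u v|u v|v]; rewrite !s1C.
  - exact: adj1.
  - exact: parC.
  - exact: parE.
have [pb parb] : path E rho (rcons (rev sb) h) /\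
    {in rev sb, forall a, exists2 p, p \in rho :: rev sb & forall u, E u a -> u = p}.
  apply: (@cycle_forward _ _ _ _ _ (rev sa)) => // [u v|u v|v]; rewrite !s2C.
  - move=> uC vC; rewrite adj1 // er !next_rotr ?rev_uniq // !next_rev // orbC.
    by rewrite !(can2_eq (next_prev us1) (prev_next us1)) [v == _]eq_sym [u == _]eq_sym.
  - exact: parC.
  - exact: parE.
have leafE u w : u \in C -> u != rho -> E w (l u) = (w == u).
  move=> uC urho; have [wC|wX] := boolP (w \in C).
    rewrite lE //; last exact: lX.
    have [->|wrho] /= := eqVneq w rho; first by rewrite eq_sym (negbTE urho).
    by rewrite (inj_in_eq linj) // !inE ?wrho ?urho.
  move: (wX); rewrite inC negbK => wX'; rewrite (negbTE (sinkX w (l u) wX')).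
  by apply/esym/negbTE; apply: contra wX => /eqP ->.
have [x0 fx0] : exists x, f x = l h by apply/fX/lX.
pose g u := odflt x0 [pick x | f x == l u].
have gE u : u \in C -> u != rho -> f (g u) = l u.
  move=> uC urho; rewrite /g; case: pickP => [x /eqP //|none] /=.
  by have /fX[x fx] := lX u uC urho; have := none x; rewrite fx eqxx.
pose v x := odflt rho [pick u | [&& u \in C, u != rho & l u == f x]].
have vg u : u \in C -> u != rho -> v (g u) = u.
  move=> uC urho; rewrite /v; case: pickP => [u' /and3P[u'C u'rho /eqP]|/(_ u)] /=.
    by rewrite gE // => /linj; apply; rewrite !inE ?u'rho ?urho.
  by rewrite gE // uC urho eqxx.
have sinkf x u : ~~ E (f x) u by apply: sinkX; apply/fX; exists x.
(* Labels change at the first step below the root, so both sides start with the negation of the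
   root's bit. *)
pose c := ~~ isl1 (t rho).
have ginj u u' : u \in C -> u != rho -> u' \in C -> u' != rho ->
    g u = g u' -> u = u'.
  by move=> uC ur u'C u'r /(congr1 v); rewrite !vg.
have side sx : path E rho (rcons sx h) -> uniq (rho :: rcons sx h) ->
    {subset rcons sx h <= C} ->
    {in sx, forall a, exists2 p, p \in rho :: sx & forall u, E u a -> u = p} ->
    alternating adj c (map g (rcons sx h)).
  move=> px /= /andP[rhox ux] xC parx.
  have xr u : u \in rcons sx h -> u != rho by apply: contraTneq => ->.
  have sxin : {subset sx <= rcons sx h}.
    by move=> u ux'; rewrite mem_rcons inE ux' orbT.
  have ugx : uniq (map g (rcons sx h)).
    rewrite map_inj_in_uniq // => a b ax bx; apply: ginj; by [apply: xC|apply: xr].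
  rewrite map_rcons in ugx *; apply: (side_alternating (v := v) acE ex) => //.
  - rewrite -map_rcons sorted_map.
    have sx' : sorted E (rcons sx h) := path_sorted px.
    apply: (sub_in_sorted (P := fun u => u \in rcons sx h)) sx'; last exact/allP.
    move=> a b ax bx ab /=; rewrite !vg //; by [apply: xC|apply: xr].
  - move=> x; rewrite -map_rcons => /mapP[u ux' ->]; apply: connect1.
    rewrite vg ?gE ?leafE //; by [apply: xC|apply: xr].
  - move=> x u /mapP[u' /sxin ux' ->]; rewrite gE ?vg ?leafE //; by [apply: xC|apply: xr].
  - move=> y0 i; rewrite size_map => ix.
    have ixx : nth rho sx i \in rcons sx h by apply: sxin; apply: mem_nth.
    rewrite (nth_map rho) // vg; [|exact: xC|exact: xr].
    rewrite /c addNb -addbN.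
    (* Alternation is counted from [rho], so position [i] of [sx] is position [i.+1] here. *)
    have := path_alternate (b := fun u => isl1 (t u)) (x := rho) (s := sx).
    move/(_ _ rho i.+1 ix); apply.
    have px' : path E rho sx by move: px; rewrite rcons_path => /andP[].
    (* The path stops before [h], where a label may repeat. Recording membership in [sx] shows that
       every vertex entered has a single parent and so is not hybrid. *)
    have : all (fun u => (u \in C) && ((u == rho) || (u \in sx))) (rho :: sx).
      rewrite /= rhoC eqxx /=; apply/allP=> u usx /=.
      by rewrite usx orbT andbT; apply/xC/sxin.
    move/(sub_in_path (e := E)); apply=> // a b.
    rewrite !unfold_in => /andP[aC _] /andP[bC brho] ab.
    apply: (isl1_neq lab); rewrite -?inC //; apply: qd; rewrite -?inC //.
    move=> hb; case/orP: brho => [/eqP brho|bx].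
      by rewrite brho (negbTE (indeg0_parent _ rho0)) in ab.
    have [p _ parb'] := parx _ bx; move: hb; rewrite /hybrid.
    have : indeg E b <= 1.
      by apply/card_le1_eqP => u u'; rewrite !inE => /parb' -> /parb' ->.
    by move=> le1 e; rewrite e in le1.
have ua : uniq (rho :: rcons sa h) /\ {subset rcons sa h <= C}.
  split; last by move=> u ux; rewrite -s1C -cat_rcons inE mem_cat ux !orbT.
  by move: us1; rewrite -cat_rcons -cat_cons cat_uniq => /and3P[].
have ub : uniq (rho :: rcons (rev sb) h) /\ {subset rcons (rev sb) h <= C}.
  split; last by move=> u ux; rewrite -s2C -cat_rcons inE mem_cat ux !orbT.
  by move: us2; rewrite -cat_rcons -cat_cons cat_uniq => /and3P[].
exists c, (g h), (map g sa), (map g (rev sb)).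
have permH : perm_eq (h :: sa ++ rev sb) (sa ++ h :: sb).
  by rewrite -cat1s perm_catCA perm_cat2l -cat1s perm_cat2l perm_rev.
have inH u : u \in h :: sa ++ rev sb -> u \in C /\ u != rho.
  rewrite (perm_mem permH) => ux; rewrite -s1C inE ux orbT; split=> //.
  by apply: contraTneq ux => ->; case/andP: us1.
rewrite -map_cat -map_cons; split.
- rewrite map_inj_in_uniq ?(perm_uniq permH) //; first by case/andP: us1.
  by move=> a b /inH[aC ar] /inH[bC br]; apply: ginj.
- move=> x; have [u uC lu] : exists2 u, u \in C :\ rho & l u = f x.
    by apply: lsurj; apply/fX; exists x.
  have /setD1P[ur uC'] := uC; apply/mapP; exists u.
    by rewrite (perm_mem permH); move: (s1C u); rewrite uC' inE (negbTE ur).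
  by apply: injf; rewrite gE.
- by rewrite size_map size_cat size_rev; move: size1; rewrite size_cat /= addnS.
- by case: ua ub => ? ? [? ?]; rewrite -!map_rcons; split; apply: side.
move=> _ _ /mapP[a asa ->] /mapP[b bsb ->].
have aH : a \in h :: sa ++ rev sb by rewrite inE mem_cat asa orbT.
have bH : b \in h :: sa ++ rev sb by rewrite inE mem_cat bsb !orbT.
have [[aC ar] [bC br]] := (inH a aH, inH b bH).
have nab : a != b.
  move: us1; rewrite /= cat_uniq /= => /and5P[_ _ /norP[_ /hasPn ns] _ _].
  by apply/eqP=> eab; have := ns b; rewrite -mem_rev bsb -eab /= asa => /(_ isT).
have reach y sy : y \in C -> y != rho -> path E rho (rcons sy h) -> y \in sy ->
    connect E rho (l y).
  move=> yC yr py ysy; apply: (@connect_trans _ _ y).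
    by apply: (path_connect py); rewrite inE mem_rcons inE ysy !orbT.
  by apply: connect1; rewrite leafE.
have up sx u w :
    {in sx, forall a, exists2 p, p \in rho :: sx & forall u, E u a -> u = p} ->
    u \in sx -> connect E w u -> w \in rho :: sx.
  move=> parx usx wu; apply: (connect_ancestor_closed (P := fun y => y \in rho :: sx) _ wu);
    last by rewrite inE usx orbT.
  move=> y y' yy'; rewrite inE => /orP[/eqP ey'|/parx[p px /(_ _ yy') ->] //].
  by rewrite ey' (negbTE (indeg0_parent _ rho0)) in yy'.
have above u w : u \in C -> u != rho -> connect E w (l u) ->
    w = l u \/ connect E w u.
  move=> uC ur /connect_parent[->|[u' wu']]; first by left.
  by rewrite leafE // => /eqP <-; right.
have lab_neq : l a != l b.
  by apply: contra nab => /eqP /linj ->; rewrite // !inE ?ar ?br.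
have sinkl u w : u \in C -> u != rho -> ~~ E (l u) w by move=> *; apply/sinkX/lX.
(* A common ancestor is neither of the two leaves, so it is an ancestor of both carriers; following
   parents stays within one side until [rho], where the two sides meet. *)
have common w : connect E w (l a) -> connect E w (l b) -> w = rho.
  move=> wa wb.
  have [ewa|wa'] := above _ _ aC ar wa.
    move: wb; rewrite ewa => /(connect_sink (fun u => sinkl a u aC ar))/eqP.
    by rewrite (negbTE lab_neq).
  have [ewb|wb'] := above _ _ bC br wb.
    move: wa; rewrite ewb => /(connect_sink (fun u => sinkl b u bC br))/eqP.
    by rewrite eq_sym (negbTE lab_neq).
  have := up _ _ _ para asa wa'; have := up _ _ _ parb bsb wb'.
  rewrite !inE mem_rev; case: eqP => //= _ wsb wsa.
  move: us1; rewrite /= cat_uniq /= => /and5P[_ _ /norP[_ /hasPn ns] _ _].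
  by have := ns w wsb; rewrite /= wsa.
have ra := reach _ _ aC ar pa asa; have rb := reach _ _ bC br pb bsb.
rewrite (explains_lca (a := rho) ex).
- by rewrite /c negbK.
- by apply: contra nab => /eqP /ginj ->.
move=> w; rewrite !gE //; split=> [[wa wb _]|->]; first exact: common.
by split=> // w' wa wb _; apply: common.
Qed.

(** * From alternating sequences to elementary networks *)

Section ElementaryNetwork.
Variables (k N : nat) (c : bool).
Hypotheses (lt_kN : k < N) (N_gt1 : 1 < N).
Local Notation n := (N + N).+1.

(* Cycle [0 .. N] with root [0] and hybrid vertex [k.+1]; the leaf [N + i]
   hangs from the cycle vertex [i > 0]. *)
Definition elem_edge : rel 'I_n := fun i j =>
  (i <= N) && [|| (i <= k) && (j == i.+1 :> nat),
                  (k < j) && ((j == N :> nat) && (i == 0 :> nat) || (i == j.+1 :> nat)) |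
                  (0 < i) && (j == N + i :> nat)].
Definition elem_leaves : {set 'I_n} := [set i : 'I_n | N < i].
(** Parity of the distance from the root along the vertex's own side, which is [i] up to [k.+1] and
    [N.+1 - i] beyond. The root gets [~~ c], and distance one gives [c]. *)
Definition elem_bit (i : nat) : bool :=
  if i <= k.+1 then c (+) ~~ odd i else c (+) ~~ odd (N.+1 - i).
Definition elem_label (i : 'I_n) : label :=
  if N < i then lodot else if elem_bit i then l1 else l0.

Lemma elem_edge_acyclic : acyclic elem_edge.
Proof.
(* The rank is the distance from the root on each side; the hybrid vertex gets [N], above both
   sides, and leaves keep their numbers beyond [N]. *)
apply: (@rank_acyclic _ _ (fun i : 'I_n =>
  if i <= k then i : nat else if i == k.+1 :> nat then N
  else if i <= N then N.+1 - i else i)) => u v.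
by rewrite /elem_edge; do 6?case: ifP; lia.
Qed.

Lemma elem_indeg0 : indeg elem_edge ord0 = 0.
Proof. by apply: card_set_eq0 => u; rewrite /elem_edge /=; lia. Qed.

Lemma elem_indeg2 (v : 'I_n) : v = k.+1 :> nat -> indeg elem_edge v = 2.
Proof.
(* The second parent of the hybrid vertex is the root itself when the second side is empty. *)
move=> vk; pose d := if k.+1 == N then 0 else k.+2.
have dE : k.+1 = N /\ d = 0 \/ k.+1 < N /\ d = k.+2.
  by rewrite /d; case: eqP; lia.
apply: (@card_set_eq2 _ _ (inord k) (inord d)) => [|u].
  by rewrite eq_inord_ord ?inordK; lia.
by rewrite !eq_inord_ord /elem_edge; lia.
Qed.

Lemma elem_indeg1 (v : 'I_n) : v != 0 :> nat -> v != k.+1 :> nat ->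
  indeg elem_edge v = 1.
Proof.
move=> v0 vk; have vn := ltn_ord v.
pose p := if v <= k then v.-1 else if v == N :> nat then 0
          else if v < N then v.+1 else v - N.
have pE : v <= k /\ p = v.-1 \/ k < v /\ v = N :> nat /\ p = 0 \/
          k < v /\ v < N /\ p = v.+1 \/ N < v /\ p = v - N.
  rewrite /p; case: (leqP v k) => ?; first by lia.
  case: (nat_of_ord v =P N) => ?; first by lia.
  by case: (ltnP v N) => ?; lia.
have pn : p < n by lia.
by apply: (@card_set_eq1 _ _ (inord p)) => u; rewrite eq_inord_ord /elem_edge; lia.
Qed.

Lemma elem_outdeg2 (u : 'I_n) : u <= N -> u != k.+1 :> nat ->
  1 < outdeg elem_edge u.
Proof.
move=> uN uk; apply/card_gt1P.
(* The root carries no leaf; its second child is [N], distinct from its child [1] because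
   [1 < N]. *)
pose d1 := if u == 0 :> nat then N else N + u.
pose d2 := if u <= k then u.+1 else u.-1.
have d1E : u = 0 :> nat /\ d1 = N \/ 0 < u /\ d1 = N + u.
  by rewrite /d1; case: (nat_of_ord u =P 0) => ?; lia.
have d2E : u <= k /\ d2 = u.+1 \/ k.+1 < u /\ d2 = u.-1.
  by rewrite /d2; case: (leqP u k) => ?; lia.
exists (inord d1), (inord d2); rewrite !inE /elem_edge eq_inord_ord; last lia.
by rewrite !inordK; [split|..]; lia.
Qed.

Lemma elem_outdeg1 (u : 'I_n) : u = k.+1 :> nat -> 0 < outdeg elem_edge u.
Proof.
move=> uk; apply/card_gt0P; exists (inord (N + k.+1)).
by rewrite inE /elem_edge inordK; lia.
Qed.

Lemma elem_outdeg0 (u : 'I_n) : N < u -> outdeg elem_edge u = 0.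
Proof. by move=> mu; apply: card_set_eq0 => v; rewrite /elem_edge; lia. Qed.

Lemma elem_network : network elem_edge elem_leaves.
Proof.
split; first exact: elem_edge_acyclic.
right; exists ord0; split.
- exact: elem_indeg0.
- by apply: elem_outdeg2.
- move=> v v0; apply: val_inj => /=; apply/eqP/negPn/negP => vn0.
  have [vk|vk] := eqVneq (v : nat) k.+1; first by rewrite elem_indeg2 in v0.
  by rewrite elem_indeg1 in v0.
- move=> x; rewrite inE; split=> [mx|[x0 _]].
    by rewrite elem_outdeg0 // elem_indeg1 //; lia.
  rewrite ltnNge; apply/negP=> xN.
  have [/elem_outdeg1|/(elem_outdeg2 xN)] := eqVneq (x : nat) k.+1; by rewrite x0.
- move=> v v0; rewrite inE -leqNgt => vN.
  have [vk|vk] := eqVneq (v : nat) k.+1.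
    by right; rewrite elem_indeg2 // elem_outdeg1.
  by left; rewrite elem_outdeg2 // elem_indeg1.
Qed.

Lemma elem_elementary : elementary elem_edge elem_leaves.
Proof.
pose s : seq 'I_n := map inord (iota 0 N.+1).
have vP i : i <= N -> (inord i : 'I_n) = i :> nat by move=> iN; rewrite inordK; lia.
have szs : size s = N.+1 by rewrite size_map size_iota.
have us : uniq s.
  rewrite map_inj_in_uniq ?iota_uniq // => i j; rewrite !mem_iota /= => iN jN.
  by move/(congr1 val); rewrite /= !vP.
have sC u : (u \in s) = (u \in ~: elem_leaves).
  rewrite in_setC [u \in elem_leaves]inE -leqNgt.
  apply/mapP/idP=> [[i]|uN].
    by rewrite mem_iota => /= iN ->; rewrite vP.
  by exists (u : nat); [rewrite mem_iota | rewrite inord_val].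
have nths x i : i <= N -> nth x s i = inord i.
  by move=> iN; rewrite (nth_map 0) ?size_iota // nth_iota.
have es : s = inord 0 :: map inord (iota 1 N) by [].
have nextE (u v : 'I_n) : u <= N ->
    (next s u == v) = ((u < N) && (v == u.+1 :> nat) || (u == N :> nat) && (v == 0 :> nat)).
  move=> uN; have us' : u \in s by rewrite sC in_setC inE -leqNgt.
  have iu : index u s = u.
    by rewrite -{1}[u]inord_val -(nths ord0) // index_uniq // szs.
  rewrite next_nth us' iu {1}es /= eq_sym.
  have [ltuN|geuN] := ltnP u N.
    by rewrite (nth_map 0) ?size_iota // nth_iota // add1n eq_inord_ord; lia.
  by rewrite nth_default ?size_map ?size_iota // eq_inord_ord; lia.
exists (~: elem_leaves), ord0, (inord k.+1), s, (fun u => inord (N + u)); split.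
- split=> //; have cC : #|~: elem_leaves| = N.+1.
    by rewrite -szs -(card_uniqP us); apply: eq_card => u; rewrite sC.
  by have := cardsC elem_leaves; rewrite cC card_ord; lia.
- split; rewrite ?inE -?leqNgt ?vP //; first exact: elem_indeg0.
  by apply: elem_indeg2; rewrite vP.
- split=> // [|u v]; first by rewrite szs.
  rewrite !inE -!leqNgt => uN vN; rewrite !nextE // /elem_edge; lia.
- by move=> x v; rewrite inE /elem_edge; lia.
have lP (u : 'I_n) : u <= N -> (inord (N + u) : 'I_n) = N + u :> nat.
  by move=> uN; rewrite inordK //; lia.
split.
- move=> u x; rewrite !inE -leqNgt => uN xN; have xn := ltn_ord x.
  rewrite [inord _ == _]eq_sym eq_inord_ord -?val_eqE /elem_edge /=; lia.
- move=> u; rewrite !inE -leqNgt -val_eqE /= => uN u0; rewrite lP //; lia.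
- move=> u v; rewrite !inE -!leqNgt => /andP[_ uN] /andP[_ vN].
  by move/(congr1 val); rewrite /= !lP // => /addnI /val_inj.
- move=> x; rewrite inE => Nx; have xn := ltn_ord x.
  have eN : (inord (x - N) : 'I_n) = x - N :> nat by rewrite inordK; lia.
  exists (inord (x - N)); first by rewrite !inE -val_eqE /= eN; lia.
  by apply: val_inj; rewrite /= lP eN; lia.
Qed.

Lemma elem_labeling : labeling elem_leaves elem_label.
Proof.
by move=> v; rewrite inE /elem_label; case: ltnP => //= _; split=> //; case: ifP.
Qed.

Lemma elem_quasi_discriminating :
  quasi_discriminating elem_edge elem_leaves elem_label.
Proof.
move=> u v uv; rewrite !inE /elem_label -!leqNgt => uN vN hv.
have vk : v != k.+1 :> nat by apply/eqP => /elem_indeg2.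
rewrite !(ltnNge N) uN vN /=; suff : elem_bit u != elem_bit v.
  by case: (elem_bit u) (elem_bit v) => -[].
have [[uk ev]|[[kv [ev eu]]|[kv ev]]] :
    u <= k /\ v = u.+1 :> nat \/ (k < v /\ v = N :> nat /\ u = 0 :> nat) \/
    k < v /\ u = v.+1 :> nat.
  by move: uv; rewrite /elem_edge; lia.
- by rewrite /elem_bit ev !ifT /=; [case: (c) (odd u) => -[] | lia..].
- rewrite /elem_bit eu /= ifF; last by lia.
  by rewrite ev subSn // subnn; case: (c).
- by rewrite /elem_bit !ifF; lia.
Qed.

Lemma elem_root_connect (v : 'I_n) : connect elem_edge ord0 v.
Proof.
have vP i : i <= N -> (inord i : 'I_n) = i :> nat by move=> iN; rewrite inordK; lia.
have fwd i : i <= k.+1 -> connect elem_edge ord0 (inord i).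
  elim: i => [|i IH] ik.
    by rewrite (_ : inord 0 = ord0) //; apply: val_inj; rewrite /= vP.
  apply: connect_trans (IH (ltnW ik)) (connect1 _).
  by rewrite /elem_edge !vP; lia.
have bwd j : j < N - k -> connect elem_edge ord0 (inord (N - j)).
  elim: j => [|j IH] jk.
    by apply: connect1; rewrite /elem_edge !vP /=; lia.
  apply: connect_trans (IH (ltnW jk)) (connect1 _).
  by rewrite /elem_edge !vP; lia.
have cyc i : i <= N -> connect elem_edge ord0 (inord i).
  move=> iN; have [/fwd //|ki] := leqP i k.+1.
  by rewrite -(subKn iN); apply: bwd; lia.
have [/cyc|Nv] := leqP v N; first by rewrite inord_val.
have vn := ltn_ord v.
have vN : v - N <= N by lia.
apply: connect_trans (cyc _ vN) (connect1 _).
by rewrite /elem_edge vP //; lia.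
Qed.

(** The leaf [x] hangs from the first side and [y] from the second. Two sets closed under parents
    contain their respective ancestors and meet only in the root. *)
Lemma elem_lca_cross (x y : 'I_n) : N < x <= N + k -> N + k.+1 < y ->
  forall w, is_lca elem_edge x y w <-> w = ord0.
Proof.
move=> xa yb.
have common w : connect elem_edge w x -> connect elem_edge w y -> w = ord0.
  move=> wx wy.
  have wa : (w <= k) || (N < w <= N + k).
    apply: (connect_ancestor_closed
      (P := fun v : 'I_n => (v <= k) || (N < v <= N + k)) _ wx); last by rewrite xa orbT.
    by move=> u v; rewrite /elem_edge; lia.
  have wb : [|| w == 0 :> nat, k.+1 < w <= N | N + k.+1 < w].
    apply: (connect_ancestor_closed
      (P := fun v : 'I_n => [|| v == 0 :> nat, k.+1 < v <= N | N + k.+1 < v]) _ wy);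
      last by rewrite yb !orbT.
    by move=> u v; rewrite /elem_edge; lia.
  by apply: val_inj => /=; lia.
move=> w; split=> [[wx wy _]|->]; first exact: common.
by split=> [||w' wx wy _]; [exact: elem_root_connect..|exact: common].
Qed.

End ElementaryNetwork.

(** On the cycle, [sa] occupies [1 .. k], [h] the hybrid vertex [k.+1], and [sb] the numbers from
    [N] downwards. Pairs on one side are settled by [side_explains], crossing pairs by the root. *)
Lemma alternating_elementary (T : finType) (adj : rel T) c h sa sb :
  symmetric adj -> uniq (h :: sa ++ sb) -> (forall x : T, x \in h :: sa ++ sb) ->
  0 < size (sa ++ sb) ->
  alternating adj c (rcons sa h) -> alternating adj c (rcons sb h) ->
  {in sa & sb, forall a b, adj a b = ~~ c} ->
  elem_qd_explainable adj.
Proof.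
move=> adj_sym us cov sz alta altb cross.
set k := size sa; pose N := (k + size sb).+1.
have lt_kN : k < N by rewrite ltnS leq_addr.
have N1 : 1 < N by rewrite ltnS -size_cat.
have [hsa hsb ua ub dis] : [/\ h \notin sa, h \notin sb, uniq sa, uniq sb &
    forall x, x \in sb -> x \notin sa].
  move: us; rewrite /= mem_cat negb_or cat_uniq => /andP[/andP[? ?]] /and3P[? ns ?].
  by split=> // x xb; apply: contra ns => xa; apply/hasP; exists x.
have uah : uniq (rcons sa h) by rewrite rcons_uniq hsa.
have ubh : uniq (rcons sb h) by rewrite rcons_uniq hsb.
have cases x : x \in rcons sa h \/ x \in sb.
  by have := cov x; rewrite mem_rcons !inE mem_cat orbA => /orP.
have szah : size (rcons sa h) = k.+1 by rewrite size_rcons.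
have szbh : size (rcons sb h) = (size sb).+1 by rewrite size_rcons.
have idxa x : x \in rcons sa h -> index x (rcons sa h) <= k.
  by rewrite -index_mem szah.
have idxb x : x \in rcons sb h -> index x (rcons sb h) <= size sb.
  by rewrite -index_mem szbh.
(* The shared entry [h] is placed through [sa]; [posb] checks that the formula for [sb] gives it the
   same number. *)
pose pos x := if x \in rcons sa h then (index x (rcons sa h)).+1
              else N - index x (rcons sb h).
have sbna x : x \in sb -> x \in rcons sa h = false.
  move=> xb; rewrite mem_rcons inE (negbTE (dis x xb)) orbF.
  by apply/negbTE; apply: contra hsb => /eqP <-.
have idxh s : h \notin s -> index h (rcons s h) = size s.
  by move=> hs; rewrite -cats1 index_cat (negbTE hs) /= eqxx addn0.
have posa x : x \in rcons sa h -> pos x = (index x (rcons sa h)).+1.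
  by rewrite /pos => ->.
have posb x : x \in rcons sb h -> pos x = N - index x (rcons sb h).
  rewrite mem_rcons inE => /orP[/eqP ->|/sbna xb]; last by rewrite /pos xb.
  by rewrite posa ?mem_rcons ?mem_head // !idxh // /N subSn ?leq_addl // addnK.
have sbh x : x \in sb -> x \in rcons sb h by rewrite mem_rcons inE => ->; rewrite orbT.
have sah x : x \in sa -> x \in rcons sa h by rewrite mem_rcons inE => ->; rewrite orbT.
have posN x : 0 < pos x <= N.
  have [xa|xb] := cases x; first by rewrite posa //=; apply: leq_trans (idxa x xa) _.
  by rewrite posb ?sbh //; have := idxb x (sbh x xb); rewrite /N; clear; lia.
have posk x : x \in sb -> k.+1 < pos x.
  move=> xb; rewrite posb ?sbh // -cats1 index_cat xb; move: xb; rewrite -index_mem /N.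
  by clear; lia.
have posk' x : x \in sa -> pos x <= k.
  move=> xa; rewrite posa ?sah // -cats1 index_cat xa; move: xa; rewrite -index_mem.
  by [].
(* The inverse of [pos] on [1 .. N]; it makes [f] injective and finds the element behind each
   leaf. *)
pose tau p := if p <= k.+1 then nth h (rcons sa h) p.-1 else nth h (rcons sb h) (N - p).
have posK : cancel pos tau.
  move=> x; have [xa|xb] := cases x.
    by rewrite /tau posa // ltnS idxa // nth_index.
  rewrite /tau leqNgt posk //= posb ?sbh // subKn ?nth_index ?sbh //.
  by apply: leq_trans (idxb x (sbh x xb)) _; rewrite /N -addSn leq_addl.
have tauK p : 0 < p <= N -> pos (tau p) = p.
  case/andP=> p0 pN; rewrite /tau; case: leqP => pk.
    have pk' : p.-1 < size (rcons sa h) by rewrite szah prednK.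
    by rewrite posa ?mem_nth // index_uniq // prednK.
  have pk' : N - p < size (rcons sb h) by rewrite szbh /N; move: pk pN; clear; lia.
  by rewrite posb ?mem_nth // index_uniq // subKn.
pose f x : 'I_(N + N).+1 := inord (N + pos x).
pose v x : 'I_(N + N).+1 := inord (pos x).
have fE x : f x = N + pos x :> nat.
  by rewrite inordK // ltnS leq_add2l; case/andP: (posN x).
have vE x : v x = pos x :> nat.
  by rewrite inordK //; case/andP: (posN x) => _ le; rewrite ltnS (leq_trans le) ?leq_addr.
have injf : injective f.
  by move=> x y /(congr1 val); rewrite /= !fE => /addnI /(can_inj posK).
have pendant x u : elem_edge k u (f x) = (u == v x).
  rewrite -val_eqE /= vE /elem_edge fE; have := posN x; move: (pos x) => p.
  by have := ltn_ord u; move: lt_kN; clear; lia.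
have sinkf x u : ~~ elem_edge k (f x) u.
  by rewrite /elem_edge fE; have := posN x; clear; lia.
have cv x : connect (@elem_edge k N) (v x) (f x) by apply: connect1; rewrite pendant.
have bitE x : elem_label k c (v x) = if elem_bit k N c (pos x) then l1 else l0.
  by rewrite /elem_label vE ltnNge; case/andP: (posN x) => _ ->.
have isl1E (b : bool) : isl1 (if b then l1 else l0) = b by case: b.
exists (N + N).+1, (@elem_edge k N), (elem_leaves N), (@elem_label k N c), f.
split; [exact: elem_network|exact: elem_elementary|exact: elem_labeling|
        exact: elem_quasi_discriminating|].
split=> // [u|].
  rewrite inE; split=> [Nu|[x <-]]; last by rewrite fE; have := posN x; clear; lia.
  have un := ltn_ord u.
  exists (tau (u - N)); apply: val_inj; rewrite /= fE tauK; move: un Nu; clear; lia.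
have acE := @elem_edge_acyclic _ _ lt_kN N1.
have sidea := @side_explains _ adj _ _ (@elem_label k N c) f v sa h c adj_sym acE injf uah.
have {}sidea : {in rcons sa h &, forall x y : T, x != y ->
    (adj x y <-> exists w, is_lca (@elem_edge k N) (f x) (f y) w /\ elem_label k c w = l1)}.
  apply: sidea => //.
  - apply/(sortedP h) => i; rewrite szah ltnS => ik.
    have i1 : i < size (rcons sa h) by rewrite szah ltnS ltnW.
    have i2 : i.+1 < size (rcons sa h) by rewrite szah.
    rewrite /= /elem_edge !vE !posa ?mem_nth // !index_uniq //.
    by move: ik lt_kN; clear; lia.
  - move=> x0 i ik; have xa : nth x0 sa i \in sa by rewrite mem_nth.
    rewrite bitE isl1E posa ?sah // -cats1 index_cat xa index_uniq // /elem_bit.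
    by rewrite ltnS ltnW //= negbK.
have sideb := @side_explains _ adj _ _ (@elem_label k N c) f v sb h c adj_sym acE injf ubh.
have {}sideb : {in rcons sb h &, forall x y : T, x != y ->
    (adj x y <-> exists w, is_lca (@elem_edge k N) (f x) (f y) w /\ elem_label k c w = l1)}.
  apply: sideb => //.
  - apply/(sortedP h) => i; rewrite szbh ltnS => ik.
    have i1 : i < size (rcons sb h) by rewrite szbh ltnS ltnW.
    have i2 : i.+1 < size (rcons sb h) by rewrite szbh.
    rewrite /= /elem_edge !vE !posb ?mem_nth // !index_uniq //.
    by move: ik lt_kN; rewrite /N; clear; lia.
  - move=> x0 i ik; have xb : nth x0 sb i \in sb by rewrite mem_nth.
    rewrite bitE isl1E /elem_bit leqNgt posk //=.
    rewrite posb ?sbh // -cats1 index_cat xb index_uniq //.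
    have iN : i <= N by apply: leq_trans (ltnW ik) _; rewrite /N -addSn leq_addl.
    by rewrite subSn ?leq_subr // subKn //= negbK.
have lcab a b : a \in sa -> b \in sb -> forall w,
    is_lca (@elem_edge k N) (f a) (f b) w <-> w = ord0.
  move=> asa bsb; apply: elem_lca_cross => //; rewrite fE.
    by have := posN a; have := posk' a asa; clear; lia.
  by have := posk b bsb; clear; lia.
have lab0 : isl1 (elem_label k c (ord0 : 'I_(N + N).+1)) = ~~ c.
  by rewrite /elem_label /= /elem_bit /= isl1E addbT.
have caseb x : x \in sa \/ x \in rcons sb h.
  case: (cases x) => [|/sbh]; last by right.
  by rewrite !mem_rcons !inE => /orP[->|]; [right|left].
(* Any pair involving [h] lies within one extended side; only a pair from [sa] and [sb] crosses. *)
move=> x y xy; have [xa|xb] := cases x; have [ya|yb] := cases y.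
- exact: sidea.
- have [xa'|xb'] := caseb x; last by apply: sideb => //; apply: sbh.
  apply: (lca_explains (lcab x y xa' yb)); by rewrite cross // lab0.
- have [ya'|yb'] := caseb y; last by apply: sideb => //; apply: sbh.
  apply: (@lca_explains _ _ _ _ _ _ _ _ ord0); last by rewrite adj_sym cross // lab0.
  by move=> w; rewrite -(lcab y x ya' xb w); split; apply: is_lca_sym.
- by apply: sideb => //; apply: sbh.
Qed.

(** * Caterpillars and polar-cats *)

(** The map [h] serves both the whole graph, as the identity, and induced subgraphs, as [val]. *)
Lemma alternating_cograph (T : finType) (adj : rel T) (T' : finType) (h : T' -> T)
    c s :
  symmetric adj -> irreflexive adj -> (forall x, h x \in s) ->
  alternating adj c s -> cograph (relpre h adj).
Proof.
by move=> adj_sym adj_irr hs alt a b d e; apply: (alternating_P4_free adj_sym adj_irr alt).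
Qed.

(** Replaces the caterpillar by a sequence ending in [w]; [s] is nonempty because a cherry has a
    second leaf. *)
Lemma caterpillar_explainable_cherryP (T : finType) (adj : rel T) w :
  symmetric adj -> irreflexive adj ->
  caterpillar_explainable_cherry adj w <->
  exists c s, [/\ s != [::], uniq (rcons s w), (forall x, x \in rcons s w) &
                  alternating adj c (rcons s w)].
Proof.
move=> adj_sym adj_irr; split=> [[_ [n [E [X [t [f [cat cher]]]]]]]|].
  exact: cat_cotree_alternating cat cher.
move=> [c [s [s0 us cov alt]]]; split.
  exact: (alternating_cograph (h := id) adj_sym adj_irr cov alt).
exact: alternating_cat_cotree alt.
Qed.

(* A lowest inner vertex has two leaves as children. *)
Lemma caterpillar_explainable_has_cherry (T : finType) (adj : rel T) :
  caterpillar_explainable adj <->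
  exists w, caterpillar_explainable_cherry adj w.
Proof.
split=> [[cog [n [E [X [t [f cat]]]]]]|[w [cog [n [E [X [t [f [cat _]]]]]]]]]; last first.
  by split=> //; exists n, E, X, t, f.
have [[[acE _] _] _ _ [_ fX _] [_ [out2 [rho [p [_ _ inP _]]]]]] := cat.
have rhoX : rho \notin X by rewrite -inP mem_head.
(* A lowest inner vertex is one with fewest descendants: an inner child would have strictly
   fewer. *)
pose below u := #|[set v | connect E u v]|.
case: (@arg_minnP _ rho (fun u => u \notin X) below rhoX) => u uX umin.
have /cards2P[c1 [c2 [neq ec]]] : #|[set v | E u v]| == 2 by apply/eqP/out2.
have childX v : E u v -> v \in X.
  move=> uv; apply: contraT => vX; have := umin v vX; rewrite leqNgt => /negP[].
  apply: proper_card; apply/properP; split.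
    apply/subsetP=> z; rewrite !inE; exact: connect_trans (connect1 uv).
  by exists u; rewrite inE ?connect0 // acE.
have [uc1 uc2] : E u c1 /\ E u c2.
  by split; [have := set21 c1 c2|have := set22 c1 c2]; rewrite -ec inE.
have /fX[w fw] := childX _ uc1.
exists w; split=> //; exists n, E, X, t, f; split=> //.
by rewrite fw; split; [exact: childX|exists c2, u; rewrite childX // eq_sym].
Qed.

Lemma map_val_lift (T : finType) (A : {set T}) s :
  {subset s <= A} -> exists s' : seq {x : T | x \in A}, map val s' = s.
Proof.
elim: s => [|x s IH] sA; first by exists [::].
have [|s' <-] := IH; first by move=> y ys; apply: sA; rewrite inE ys orbT.
by exists (Sub x (sA x (mem_head _ _)) :: s').
Qed.

(** Moves the criterion from the subtype of [A] to sequences in [T], so that both parts of a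
    polar-cat can be handled in the ambient graph. *)
Lemma induced_cherryP (T : finType) (adj : rel T) (A : {set T}) v :
  symmetric adj -> irreflexive adj ->
  (exists2 w : {x : T | x \in A}, val w = v &
     caterpillar_explainable_cherry (induced adj A) w) <->
  exists c s, [/\ s != [::], uniq (rcons s v), rcons s v =i A &
                  alternating adj c (rcons s v)].
Proof.
move=> adj_sym adj_irr.
have isym : symmetric (induced adj A) by move=> x y; apply: adj_sym.
have iirr : irreflexive (induced adj A) by move=> x; apply: adj_irr.
split=> [[w <- /(caterpillar_explainable_cherryP w isym iirr)]|].
  case=> c [s [s0 us cov /alternating_map alt]].
  exists c, (map val s); rewrite -map_rcons (map_inj_uniq val_inj); split=> //.
    by case: s s0 {us cov alt}.
  move=> x; apply/mapP/idP=> [[y _ ->]|xA]; first exact: valP.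
  by exists (Sub x xA).
case=> c [s [s0 us sA alt]].
have vA : v \in A by rewrite -sA mem_rcons mem_head.
have [|s' es'] := @map_val_lift _ A s.
  by move=> x xs; rewrite -sA mem_rcons inE xs orbT.
have es : map val (rcons s' (Sub v vA)) = rcons s v by rewrite map_rcons es'.
exists (Sub v vA) => //; apply/caterpillar_explainable_cherryP => //.
exists c, s'; split.
- by rewrite -es' in s0; case: (s') s0.
- by rewrite -(map_inj_uniq val_inj) es.
- by move=> x; rewrite -(mem_map val_inj) es sA; apply: valP.
- by apply/(alternating_map val adj); rewrite es.
Qed.

Theorem mainTheorem7 (T : finType) (adj : rel T)
  (adj_sym : symmetric adj) (adj_irr : irreflexive adj) :
  elem_qd_explainable adj <->
  ((caterpillar_explainable adj /\ 2 <= #|T|) \/ polar_cat adj).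
Proof.
have cherryP w := caterpillar_explainable_cherryP w adj_sym adj_irr.
have indP A v := @induced_cherryP T adj A v adj_sym adj_irr.
split=> [[n [E [X [t [f [netE elE lab qd ex]]]]]]|].
  have [c [h [sa [sb [us cov sz [alta altb] cross]]]]] :=
    elementary_alternating netE elE lab qd ex.
  have cardT : #|T| = (size (sa ++ sb)).+1.
    by rewrite -[RHS]/(size (h :: _)) -(card_uniqP us); apply: eq_card => x; rewrite cov.
  have cat s w c' : s != [::] -> uniq (rcons s w) -> (forall x, x \in rcons s w) ->
      alternating adj c' (rcons s w) -> caterpillar_explainable adj /\ 2 <= #|T|.
    move=> s0 usw covw alt; rewrite cardT ltnS; split=> //.
    by apply/caterpillar_explainable_has_cherry; exists w; apply/cherryP; exists c', s.
  have [hsa hsb ua ub dis] : [/\ h \notin sa, h \notin sb, uniq sa, uniq sb &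
      forall x, x \in sa -> x \notin sb].
    move: us; rewrite /= mem_cat negb_or cat_uniq => /andP[/andP[? ?]] /and3P[? ns ?].
    by split=> // x xa; apply: contra ns => xb; apply/hasP; exists x.
  have uah : uniq (rcons sa h) by rewrite rcons_uniq hsa.
  have ubh : uniq (rcons sb h) by rewrite rcons_uniq hsb.
  (* An empty side leaves a single sequence, hence a caterpillar. *)
  have [sb0|sbn] := eqVneq sb [::].
    left; rewrite sb0 cats0 in cov sz; apply: (cat sa h c) => //.
      by rewrite -size_eq0 -lt0n.
    by move=> x; rewrite mem_rcons.
  have [sa0|san] := eqVneq sa [::].
    left; rewrite sa0 in cov sz; apply: (cat sb h c) => //.
    by move=> x; rewrite mem_rcons.
  have szal : 0 < size sa by rewrite lt0n size_eq0.
  have szbl : 0 < size sb by rewrite lt0n size_eq0.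
  (* With one vertex on each side there are only three vertices, too few for a polar-cat. The
     sequence [h, a, b] works: [h] has adjacency [c] to both others, and [a], [b] have adjacency
     [~~ c]. *)
  have [small|big] := leqP (size (sa ++ sb)) 2.
    have [a ea] : exists a, sa = [:: a].
      move: small szbl; rewrite size_cat; case: (sa) san => [|a [|a' s]] //= _; first by exists a.
      by rewrite !addSn !ltnS leqn0 addn_eq0 => /andP[_ /eqP ->].
    have [b eb] : exists b, sb = [:: b].
      move: small; rewrite ea; case: (sb) sbn => [|b [|b' s]] //= _; first by exists b.
    rewrite ea eb in us cov alta altb cross.
    left; apply: (cat [:: h; a] b c) => //.
    move: alta altb => /alternating_cons[ca _] /alternating_cons[cb _].
    apply/alternating_cons; split.
      by move=> x; rewrite !inE => /orP[] /eqP ->; rewrite adj_sym ?ca ?cb ?mem_head.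
    apply/alternating_cons; split; last first.
      by apply/alternating_cons; split; [|exact: alternating_nil].
    by move=> x; rewrite inE => /eqP ->; apply: cross; rewrite mem_head.
  (* The extended sides are the two parts. Each is connected exactly when [c] holds, while adjacency
     across is [~~ c]; the two values of [c] thus give the two polar cases. *)
  right; exists h, [set x in rcons sa h], [set x in rcons sb h].
  have inA (s : seq T) x : (x \in [set y in rcons s h]) = (x == h) || (x \in s).
    by rewrite inE mem_rcons inE.
  have eqA (s : seq T) : rcons s h =i [set y in rcons s h] by move=> x; rewrite inE.
  have cardA (s : seq T) : uniq (rcons s h) -> 0 < size s -> 1 < #|[set y in rcons s h]|.
    by move=> usw s0; rewrite cardsE (card_uniqP usw) size_rcons.
  have szr (s : seq T) : 0 < size s -> 1 < size (rcons s h) by rewrite size_rcons.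
  have part (s : seq T) x : x \in [set y in rcons s h] :\ h -> x \in s.
    by rewrite in_setD1 inA => /andP[/negbTE ->].
  have cog (s : seq T) : alternating adj c (rcons s h) ->
      cograph (induced adj [set y in rcons s h]).
    apply: (alternating_cograph (h := val)) => // x.
    by have := valP x; rewrite inE.
  have crossA (x y : T) : x \in [set y in rcons sa h] :\ h ->
      y \in [set y in rcons sb h] :\ h -> adj x y = ~~ c.
    by move=> /part xa /part yb; apply: cross.
  have conA := alternating_connected adj_sym adj_irr alta uah (szr _ szal) (eqA sa).
  have conB := alternating_connected adj_sym adj_irr altb ubh (szr _ szbl) (eqA sb).
  split.
  - split; rewrite ?cardA //.
    + apply/setP=> x; rewrite in_setU !inA in_setT.
      by have := cov x; rewrite inE mem_cat; case: (x == h).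
    + apply/setP=> x; rewrite in_setI !inA in_set1; case: eqP => //= _.
      by apply/negP=> /andP[/dis /negbTE ->].
    + split; [exact: cog|exact: cog|].
      case: (c) crossA => crossA; [right|left] => x y xA yB; by rewrite crossA.
  - by rewrite cardT.
  - case: (c) crossA conA conB => crossA conA conB; [left|right].
      by split; [exact/conA|split; [exact/conB|move=> x y xA yB; rewrite crossA]].
    by split; [move/conA|split; [move/conB|move=> x y xA yB; rewrite crossA]].
  - by apply/indP; exists c, sa.
  - by apply/indP; exists c, sb.
case=> [[/caterpillar_explainable_has_cherry[w /cherryP]]|].
  move=> [c [s [s0 us cov alt]]] _.
  (* A single sequence is the case of an empty second side, with the hybrid vertex a child of the
     root. *)
  apply: (@alternating_elementary T adj c w s [::]) => //.
  - by rewrite cats0; move: us; rewrite rcons_uniq.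
  - by move=> x; rewrite cats0 -mem_rcons.
  - by rewrite cats0 lt0n size_eq0.
  - by apply/alternating_cons; split; [|exact: alternating_nil].
case=> v [A1 [A2 [[cov1 capv _ _ _] _ con /indP[c1 [s1 [s10 us1 eA1 alt1]]]
  /indP[c2 [s2 [s20 us2 eA2 alt2]]]]]].
have szr (s : seq T) : s != [::] -> 1 < size (rcons s v).
  by rewrite size_rcons ltnS lt0n size_eq0.
have con1 := alternating_connected adj_sym adj_irr alt1 us1 (szr _ s10) eA1.
have con2 := alternating_connected adj_sym adj_irr alt2 us2 (szr _ s20) eA2.
move: us1 us2; rewrite !rcons_uniq => /andP[vs1 us1] /andP[vs2 us2].
have s1A x : x \in s1 -> x \in A1 :\ v.
  move=> xs; rewrite in_setD1 -eA1 mem_rcons inE xs orbT andbT.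
  by apply: contraNneq vs1 => <-.
have s2A x : x \in s2 -> x \in A2 :\ v.
  move=> xs; rewrite in_setD1 -eA2 mem_rcons inE xs orbT andbT.
  by apply: contraNneq vs2 => <-.
(* Connectivity of the parts determines both initial bits, so they agree, and in either polar case
   adjacency across is the opposite bit. *)
have [ec cross] : c1 = c2 /\ {in s1 & s2, forall a b, adj a b = ~~ c1}.
  case: con => [[/con1 e1 [/con2 e2 dj]]|[n1 [n2 jn]]].
    split=> [|a b /s1A aA /s2A bA]; first by rewrite e1 e2.
    by rewrite e1 (negbTE (dj a b aA bA)).
  have e1 : c1 = false by apply/negP=> /con1.
  have e2 : c2 = false by apply/negP=> /con2.
  by split=> [|a b /s1A aA /s2A bA]; rewrite e1 ?e2 // (jn a b aA bA).
apply: (@alternating_elementary T adj c1 v s1 s2) => //; last by rewrite ec.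
- rewrite /= mem_cat negb_or vs1 vs2 cat_uniq us1 us2 /= andbT.
  apply/hasPn=> x xs2; apply/negP=> xs1.
  have := in_setI x A1 A2; rewrite capv in_set1.
  have /setD1P[xv xA2] := s2A x xs2; have /setD1P[_ xA1] := s1A x xs1.
  by rewrite (negbTE xv) xA1 xA2.
- move=> x; have := in_setT x; rewrite -cov1 in_setU -eA1 -eA2.
  by rewrite !mem_rcons !inE mem_cat; case: (x == v).
- by rewrite size_cat addn_gt0 lt0n size_eq0 s10.
Qed.
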